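(* Let $n\geq 2$ and let $g$ be chosen from the Haar measure of $U(n,\mathbb{C})$. Let $W(g) = \frac{1}{\sqrt{2}} \left[\mathrm{Tr}(g) + \overline{\mathrm{Tr}(g)}\right]$ where $\mathrm{Tr}$ denotes trace. Then for all real $x_0$, $$\left| \mathbb{P}(W \leq x_0) - \frac{1}{\sqrt{2 \pi}} \int_{-\infty}^{x_0} e^{-\frac{x^2}{2}}\, dx \right| \leq \frac{2}{n-1}.$$
   Context: $U(n,\mathbb{C})$ is the group of $n\times n$ unitary matrices. Haar measure is normalized to be a probability measure. *)

(* Defs.v *)
From HB Require Import structures.
From mathcomp Require Import all_boot all_order all_algebra.
From mathcomp Require Import complex.
From mathcomp Require Import all_classical all_reals all_analysis.

Set Implicit Arguments.
Unset Strict Implicit.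
Unset Printing Implicit Defensive.

Import Order.TTheory GRing.Theory Num.Theory.
Import numFieldTopology.Exports.

Local Open Scope classical_set_scope.
Local Open Scope ring_scope.
Local Open Scope complex_scope.
Local Open Scope sesquilinear_scope.

(* The topology of the modulus, available generically on a numClosedFieldType
   but not inferred on the concrete carrier R[i]. *)
HB.instance Definition _ (R : realType) :=
  PseudoPointedMetric.copy R[i] (R[i] : numClosedFieldType).

Section unitary_group.
Variables (R : realType) (n : nat).

Definition unitary : Type := {g : 'M[R[i]]_n | g \is unitarymx}.

HB.instance Definition _ := SubChoice.on unitary.

Implicit Types g h : unitary.

Fact unitary_one_subproof : (1%:M : 'M[R[i]]_n) \is unitarymx.
Proof. by apply/unitarymxP; rewrite trmx1 map_mx1 mulmx1. Qed.

Fact unitary_inv_subproof g : (val g)^t* \is unitarymx.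
Proof. by rewrite trmxC_unitary; exact: (valP g). Qed.

Fact unitary_mul_subproof g h : val g *m val h \is unitarymx.
Proof. exact: mul_unitarymx (valP g) (valP h). Qed.

Definition unitary_one : unitary := Sub 1%:M unitary_one_subproof.
Definition unitary_inv g : unitary :=
  Sub ((val g)^t*) (unitary_inv_subproof g).
Definition unitary_mul g h : unitary :=
  Sub (val g *m val h) (unitary_mul_subproof g h).

Fact unitary_mulA : associative unitary_mul.
Proof. by move=> g h k; apply: val_inj; rewrite /= mulmxA. Qed.

Fact unitary_mul1g : left_id unitary_one unitary_mul.
Proof. by move=> g; apply: val_inj; rewrite /= mul1mx. Qed.

Fact unitary_mulg1 : right_id unitary_one unitary_mul.
Proof. by move=> g; apply: val_inj; rewrite /= mulmx1. Qed.

Fact unitary_mulgV : right_inverse unitary_one unitary_inv unitary_mul.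
Proof. by move=> g; apply: val_inj => /=; apply/unitarymxP/(valP g). Qed.

Fact unitary_mulVg : left_inverse unitary_one unitary_inv unitary_mul.
Proof.
by move=> g; apply: val_inj => /=; apply: mulmx1C; apply/unitarymxP/(valP g).
Qed.

HB.instance Definition _ := isGroup.Build unitary
  unitary_mulA unitary_mul1g unitary_mulg1 unitary_mulVg unitary_mulgV.

HB.instance Definition _ := isPointed.Build unitary unitary_one.

(* Subspace topology inherited from the matrix space. *)
HB.instance Definition _ := Topological.copy unitary
  (initial_topology (val : unitary -> 'M[R[i]]_n)).

End unitary_group.

Definition borelType (T : ptopologicalType) := g_sigma_algebraType (@open T).

HB.instance Definition _ (T : ptopologicalType) :=
  Measurable.on (borelType T).

(* A Haar probability measure: left-invariant Borel probability measure.  On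
   the compact group U(n) there is exactly one, and it is automatically regular
   and right-invariant. *)
Definition is_haar (R : realType) (n : nat)
    (mu : probability (borelType (unitary R n)) R) : Prop :=
  forall (g : unitary R n) (B : set (borelType (unitary R n))),
    measurable B -> mu [set (g * h)%g | h in B] = mu B.

(* The complex number is real (trace_statE); Re only changes its type to R. *)
Definition trace_stat (R : realType) (n : nat) (g : unitary R n) : R :=
  complex.Re ((sqrtC 2)^-1 * (\tr (val g) + (\tr (val g))^*)).

Lemma trace_statE (R : realType) (n : nat) (g : unitary R n) :
  (trace_stat g)%:C = (sqrtC 2)^-1 * (\tr (val g) + (\tr (val g))^*).
Proof.
apply: RRe_real; apply: realM.
  by rewrite realV ger0_real // sqrtC_ge0 ler0n.
by apply/CrealP; rewrite rmorphD /= conjCK addrC.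
Qed.

(* Main.v *)
Require Import Defs.
From mathcomp Require Import all_boot all_order all_algebra.
From mathcomp Require Import complex.
From mathcomp Require Import all_classical all_reals all_analysis.
From mathcomp Require Import measurable_realfun.
From mathcomp Require Import ring lra.

(* Stein's method with an infinitesimal rotation. For v in C^n the matrices
   1 + c(t) v v*, with c(t) = i t + O(t^2), are unitary, so left invariance of
   Haar measure annihilates the mean of every derivative along v v*; by
   polarization this gives the complexified integration by parts E[G_ij] = 0
   whenever the derivative of F along A is Tr(A G). Applied to F g_bc these are
   the Schwinger-Dyson equations n E[F g] + E[G g] = 0. With p_k = Tr(g^k) they
   yield E|p_1|^2 = 1, E|p_2|^2 = 2, E p_2^2 = 0, hence E (Re p_2)^2 = 1, and,
   for F = f(W), the identity n E[f'(W) - W f(W)] = E[f'(W) Re p_2]. If f solves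
   the Stein equation f' - x f = h - E h(Z) with h a continuous ramp in [0, 1],
   then |f'| <= 2, so |E h(W) - E h(Z)| <= (2/n) E|Re p_2| <= 2/n; letting the
   ramp steepen to the indicator of x <= x_0 concludes. *)

Set Implicit Arguments.
Unset Strict Implicit.
Unset Printing Implicit Defensive.

Import Order.TTheory GRing.Theory Num.Theory.
Import numFieldTopology.Exports numFieldNormedType.Exports.
Local Open Scope classical_set_scope.
Local Open Scope ring_scope.
Local Open Scope complex_scope.
Local Open Scope sesquilinear_scope.

(** * The Gaussian Stein equation *)

Section gauss.
Context {R : realType}.
Notation mu := (@lebesgue_measure R).
Implicit Types x y t : R.

Definition phi : R -> R := normal_pdf 0 1.

Lemma phiE x : phi x = (Num.sqrt (2 * pi))^-1 * expR (- (x ^+ 2 / 2)).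
Proof.
rewrite /phi normal_pdfE ?oner_neq0// /normal_peak /normal_fun subr0 expr1n.
by rewrite mulNr mul1r mulr_natl.
Qed.

Lemma phi_gt0 x : 0 < phi x.
Proof. by rewrite phiE mulr_gt0 ?expR_gt0// invr_gt0 sqrtr_gt0 mulr_gt0 ?pi_gt0. Qed.

Lemma phi_le1 x : phi x <= 1.
Proof.
rewrite phiE -[leRHS]mulr1 ler_pM ?invr_ge0 ?sqrtr_ge0 ?expR_ge0//.
  rewrite invf_le1 ?sqrtr_gt0 ?mulr_gt0 ?pi_gt0//.
  rewrite -[leLHS]sqrtr1 ler_wsqrtr//.
  have := pi_ge2 R; lra.
by rewrite -expR0 ler_expR oppr_le0 divr_ge0// sqr_ge0.
Qed.

Lemma phiN x : phi (- x) = phi x.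
Proof. by rewrite !phiE sqrrN. Qed.

Lemma continuous_phi : continuous phi.
Proof. exact: continuous_normal_pdf (oner_neq0 _). Qed.

Lemma integrable_phi : mu.-integrable setT (EFin \o phi).
Proof. exact: integrable_normal_pdf. Qed.

Lemma Rintegral_phi : \int[mu]_x phi x = 1.
Proof. by rewrite /Rintegral integral_normal_pdf. Qed.

Lemma is_derive_phi x : is_derive x 1 phi (- x * phi x).
Proof.
have -> : phi = (fun y => (Num.sqrt (2 * pi))^-1 * expR (- (y ^+ 2 / 2))).
  by apply/funext => y; rewrite phiE.
rewrite /=; apply: is_derive_eq.
rewrite /GRing.scale /=; field.
by rewrite sqrtr_eq0 -ltNge mulr_gt0 ?pi_gt0.
Qed.

Lemma phi_cvg0 : phi x @[x --> +oo] --> (0 : R).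
Proof.
have -> : phi = (fun y => (Num.sqrt (2 * pi))^-1 * expR (- (y ^+ 2 / 2))).
  by apply/funext => y; rewrite phiE.
rewrite -(mulr0 (Num.sqrt (2 * pi))^-1); apply: cvgMr.
apply: (@cvg_comp _ _ _ (fun y : R => y ^+ 2 / 2) (fun y => expR (- y)) _ +oo);
  last exact: cvgr_expR.
by apply: gt0_cvgMly => //; exact: cvgr_expr2.
Qed.

Lemma integrable_mul_phi (k : R -> R) (C : R) : continuous k ->
  (forall x, `|k x| <= C) -> mu.-integrable setT (EFin \o (fun x => k x * phi x)).
Proof.
move=> ck kC.
apply: (@le_integrable _ _ _ mu setT _ _ (fun x => (C * phi x)%:E)) => //.
- apply/measurable_EFinP; apply: continuous_measurable_fun => x.
  by apply: cvgM; [exact: ck|exact: continuous_phi].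
- move=> x _ /=; rewrite lee_fin !normrM ler_wpM2r//.
  by rewrite (le_trans (kC x))// ler_norm.
- by rewrite (_ : (fun _ => _) = (fun x => C%:E * (EFin \o phi) x)%E);
    [exact: (integrableZl measurableT C integrable_phi)|].
Qed.

Lemma integrableS_itv (i : interval R) (f : R -> R) :
  mu.-integrable setT (EFin \o f) -> mu.-integrable [set` i] (EFin \o f).
Proof. by apply: integrableS. Qed.

(** Since [phi' = - t phi], a primitive of [t phi t] is [- phi], which vanishes at [+oo]. *)
Lemma integral_mean_tail x : 0 < x ->
  (\int[mu]_(t in `[x, +oo[) (t * phi t)%:E = (phi x)%:E)%E.
Proof.
move=> x0.
rewrite (@ge0_continuous_FTC2y _ (fun t => t * phi t) (fun t => - phi t) x 0).
- by rewrite EFinN oppeK add0e.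
- by move=> t xt; rewrite mulr_ge0 ?(ltW (phi_gt0 _))// (le_trans (ltW x0)).
- by apply: continuous_subspaceT => t; apply: cvgM => //; exact: continuous_phi.
- by rewrite -oppr0; apply: cvgN; exact: phi_cvg0.
- by move=> t _; apply: derivableN; case: (is_derive_phi t).
- by apply: cvg_at_right_filter; apply: cvgN; exact: continuous_phi.
- move=> t _; rewrite derive1E deriveN; last by case: (is_derive_phi t).
  by have [_ ->] := is_derive_phi t; rewrite mulNr opprK.
Qed.

(* The Mills ratio bound: x phi(t) <= t phi(t) = - phi'(t) for t >= x. *)
Lemma gauss_tail_ge x : 0 < x -> x * \int[mu]_(t in `[x, +oo[) phi t <= phi x.
Proof.
move=> x0; have ip := @integrableS_itv `[x, +oo[ phi integrable_phi.
rewrite -RintegralZl// -lee_fin /Rintegral fineK; last first.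
  apply: integrable_fin_num => //.
  by apply: (integrableZl _ _ ip); exact: measurable_itv.
rewrite -integral_mean_tail//; apply: ge0_le_integral => //.
- by move=> t _; rewrite lee_fin mulr_ge0 ?(ltW x0)// ltW// phi_gt0.
- by apply/measurable_EFinP; apply: measurable_funTS; apply: continuous_measurable_fun => t;
    apply: cvgM; [exact: cvg_cst|exact: continuous_phi].
- by apply/measurable_EFinP; apply: measurable_funTS; apply: continuous_measurable_fun => t;
    apply: cvgM => //; exact: continuous_phi.
- move=> t; rewrite /= in_itv/= andbT => xt.
  by rewrite lee_fin ler_wpM2r// ltW// phi_gt0.
Qed.

(** Evenness of [phi] turns the left tail at [x] into the right tail at [- x]. *)
Lemma gauss_tail_le x : x < 0 ->
  - x * \int[mu]_(t in `]-oo, x]) phi t <= phi x.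
Proof.
move=> x0; rewrite -phiN.
suff -> : \int[mu]_(t in `]-oo, x]) phi t = \int[mu]_(t in `[- x, +oo[) phi t.
  by apply: gauss_tail_ge; rewrite oppr_gt0.
rewrite /Rintegral -{1}[x]opprK ge0_integration_by_substitutionNy.
- by congr fine; apply: eq_integral => t _ /=; rewrite phiN.
- by apply: continuous_subspaceT; exact: continuous_phi.
- by move=> t _; rewrite ltW// phi_gt0.
Qed.

(** * The Stein equation with a bounded, centred right-hand side *)

Section stein_equation.
Variable k : R -> R.
Hypothesis ck : continuous k.
Hypothesis k_le1 : forall x, `|k x| <= 1.
Hypothesis k_mean0 : \int[mu]_x (k x * phi x) = 0.

Let ikp := integrable_mul_phi ck k_le1.
Let F x := \int[mu]_(t in `]-oo, x]) (k t * phi t).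

(** Since [phi' = - x phi], the equation [f' - x f = k] says that [f phi] is a primitive of [k phi];
    the primitive vanishing at [-oo] is the choice that keeps [x f] bounded. *)
Definition stein_sol x := F x / phi x.

Lemma is_derive_stein_sol x : is_derive x 1 stein_sol (x * stein_sol x + k x).
Proof.
(* Any endpoint to the right of [x] would do in place of [x + 1]. *)
have [] := @continuous_FTC1 R (fun t => k t * phi t) -oo%O x (x + 1).
- by rewrite ltrDl.
- exact: integrableS_itv.
- by rewrite ltNyr.
- by apply: cvgM; [exact: ck|exact: continuous_phi].
rewrite -/F derive1E => dF F'.
have isF : is_derive x 1 F (k x * phi x) by rewrite -F'; exact/derivableP.
have phi0 : phi x != 0 by rewrite gt_eqF// phi_gt0.
have isV : is_derive x 1 (fun y => (phi y)^-1) (- (phi x) ^- 2 *: (- x * phi x)).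
  by apply: is_deriveV => //; exact: is_derive_phi.
by rewrite /stein_sol; apply: is_derive_eq; rewrite /GRing.scale /=; field.
Qed.

(** As [|k| <= 1], the numerator [F x] is dominated by a Gaussian tail, and the Mills bound on this
    tail compensates the division by [phi x]. *)
Lemma abs_mul_stein_sol_le x : `|x * stein_sol x| <= 1.
Proof.
rewrite /stein_sol mulrA normrM normfV (ger0_norm (ltW (phi_gt0 x))).
rewrite ler_pdivrMr ?phi_gt0// mul1r normrM.
have Fle (i : interval R) : `|\int[mu]_(t in [set` i]) (k t * phi t)|
    <= \int[mu]_(t in [set` i]) phi t.
  apply: (le_trans (le_normr_Rintegral _ _)) => //; first exact: integrableS_itv.
  apply: le_Rintegral => //.
  - have := integrable_norm (integrableS_itv i ikp).
    by apply: eq_integrable => // t _.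
  - exact: integrableS_itv integrable_phi.
  - move=> t _; rewrite normrM (ger0_norm (ltW (phi_gt0 t))).
    by rewrite ler_piMl// ltW// phi_gt0.
have [x0|x0|->] := ltgtP x 0; last by rewrite normr0 mul0r ltW// phi_gt0.
- rewrite ltr0_norm//; apply: le_trans (gauss_tail_le x0).
  by rewrite ler_wpM2l ?oppr_ge0 ?(ltW x0)// Fle.
- rewrite gtr0_norm//; apply: le_trans (gauss_tail_ge x0).
  rewrite ler_wpM2l ?(ltW x0)//.
  (* For positive [x] the mass to the left is not small; the zero mean of [k] trades it for the
     right tail. *)
  suff -> : F x = - \int[mu]_(t in `[x, +oo[) (k t * phi t).
    by rewrite normrN Fle.
  rewrite -Rintegral_itv_obnd_cbnd; last exact: integrableS_itv.
  rewrite -(@Rintegral_itvB _ _ -oo%O +oo%O)//=; last exact: integrableS_itv.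
  by rewrite set_itvNyy k_mean0 sub0r opprK.
Qed.


Lemma continuous_stein_sol : continuous stein_sol.
Proof.
move=> x; apply/differentiable_continuous/derivable1_diffP.
by have [] := is_derive_stein_sol x.
Qed.

Lemma stein_sol_deriv_le2 x : `|x * stein_sol x + k x| <= 2.
Proof.
rewrite (le_trans (ler_normD _ _))// -[leRHS]/(1 + 1).
by rewrite lerD ?abs_mul_stein_sol_le.
Qed.

Lemma stein_sol_mvt x y :
  exists2 c, (Num.min x y <= c <= Num.max x y) &
    stein_sol y - stein_sol x = (c * stein_sol c + k c) * (y - x).
Proof.
have D (z : R) : is_derive z 1 stein_sol (z * stein_sol z + k z).
  exact: is_derive_stein_sol.
have C (a b : R) : {within `[a, b], continuous stein_sol}.
  exact/continuous_subspaceT/continuous_stein_sol.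
have [xy|yx] := leP x y.
- have [c] := MVT_segment xy (fun z _ => D z) (@C _ _).
  by rewrite in_itv/= => cxy ->; exists c.
- have [c] := MVT_segment (ltW yx) (fun z _ => D z) (@C _ _).
  rewrite in_itv/= => cxy E; exists c => //.
  by rewrite -opprB E -mulrN opprB.
Qed.

Hypothesis k_lip : exists L : R, forall x y, `|k x - k y| <= L * `|x - y|.

(** With [k] only Lipschitz the solution need not be twice differentiable, but its derivative is
    Lipschitz on bounded sets, which suffices for a quadratic remainder. *)
Lemma stein_sol_taylor (M : R) : exists C : R, forall x y, `|x| <= M -> `|y| <= M ->
  `|stein_sol y - stein_sol x - (x * stein_sol x + k x) * (y - x)|
    <= C * (y - x) ^+ 2.
Proof.
have [L kL] := k_lip.
have [B Bf] : exists B : R, forall x, `|x| <= M -> `|stein_sol x| <= B.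
  have := @compact_bounded _ R^o (stein_sol @` `[- M, M]).
  move=> /(_ _)[|B [_ HB]].
    apply: continuous_compact; last exact: segment_compact.
    exact/continuous_subspaceT/continuous_stein_sol.
  (* Boundedness is given as a property of every number strictly above [B], hence the [+ 1]. *)
  exists (B + 1) => x xM; apply: (HB (B + 1)); first by rewrite ltrDl.
  by exists x => //; rewrite /= in_itv/= -ler_norml.
(* The derivatives at [x] and at the intermediate point differ by three terms: [B] bounds the
   solution on [[-M, M]], [M * 2] uses the bound 2 on the derivative, and [L] comes from [k]. *)
exists (B + M * 2 + L) => x y xM yM.
have [c /andP[c1 c2] ->] := stein_sol_mvt x y.
have cM : `|c| <= M.
  move: xM yM c1 c2; rewrite !ler_norml minElt maxElt.
  by case: ltP; lra.
have cx : `|c - x| <= `|y - x|.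
  move: c1 c2; rewrite minElt maxElt; case: ltP => xy c1 c2.
    by rewrite !ger0_norm; lra.
  by rewrite !ler0_norm; lra.
rewrite -mulrBl normrM -[(y - x) ^+ 2]real_normK ?num_real//.
rewrite expr2 [leRHS]mulrA ler_wpM2r//.
have -> : c * stein_sol c + k c - (x * stein_sol x + k x) =
  (c - x) * stein_sol c + x * (stein_sol c - stein_sol x) + (k c - k x) by ring.
have [d _ ->] := stein_sol_mvt x c.
have M0 : 0 <= M by apply: le_trans xM.
have L0 : 0 <= L.
  by have := kL 0 1; rewrite sub0r normrN normr1 mulr1; apply: le_trans.
have B0 : 0 <= B by apply: le_trans (Bf c cM).
apply: (le_trans (ler_normD _ _)); rewrite [leRHS]mulrDl.
rewrite lerD//; last by apply: (le_trans (kL _ _)); rewrite ler_wpM2l.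
apply: (le_trans (ler_normD _ _)); rewrite [leRHS]mulrDl.
rewrite lerD//.
  by rewrite normrM mulrC ler_pM// Bf.
rewrite !normrM [leLHS]mulrA ler_pM// ?mulr_ge0//.
by rewrite ler_pM// stein_sol_deriv_le2.
Qed.

End stein_equation.

(** * Ramps: continuous approximations of the indicator of a half-line *)

Definition ramp x0 e x : R := Num.max 0 (Num.min 1 ((x0 + e - x) / e)).

Section ramp.
Variables x0 e : R.
Hypothesis e0 : 0 < e.

Lemma ramp_ge0 x : 0 <= ramp x0 e x.
Proof. by rewrite /ramp le_max lexx. Qed.

Lemma ramp_le1 x : ramp x0 e x <= 1.
Proof. by rewrite /ramp ge_max ler01 ge_min lexx. Qed.

Lemma ramp1 x : x <= x0 -> ramp x0 e x = 1.
Proof.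
move=> xx0; rewrite /ramp min_l; first by rewrite max_r.
by rewrite ler_pdivlMr// mul1r; lra.
Qed.

Lemma ramp0 x : x0 + e <= x -> ramp x0 e x = 0.
Proof.
move=> xx0; rewrite /ramp max_l// ge_min; apply/orP; right.
by rewrite pmulr_lle0 ?invr_gt0//; lra.
Qed.

(** Clipping by [max 0] and [min 1] does not increase distances, so the slope of the affine part
    gives the constant. *)
Lemma ramp_lip x y : `|ramp x0 e x - ramp x0 e y| <= e^-1 * `|x - y|.
Proof.
have cmax (a b : R) : `|Num.max 0 a - Num.max 0 b| <= `|a - b|.
  have := ler_norm (a - b); have := ler_norm (b - a); rewrite distrC.
  move: `|a - b| => t bat abt.
  by rewrite ler_norml !maxElt; case: ltP => ?; case: ltP => ?; lra.
have cmin (a b : R) : `|Num.min 1 a - Num.min 1 b| <= `|a - b|.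
  have := ler_norm (a - b); have := ler_norm (b - a); rewrite distrC.
  move: `|a - b| => t bat abt.
  by rewrite ler_norml !minElt; case: ltP => ?; case: ltP => ?; lra.
rewrite (le_trans (cmax _ _))// (le_trans (cmin _ _))//.
rewrite -mulrBl normrM [leRHS]mulrC normfV (gtr0_norm e0).
rewrite ler_wpM2r ?invr_ge0 ?(ltW e0)//.
by rewrite (_ : _ - _ - _ = y - x) 1?distrC//; ring.
Qed.

Lemma continuous_ramp : continuous (ramp x0 e).
Proof.
move=> x; apply/cvgrPdist_lt => d d0; apply/nbhs_ballP.
exists (e * d); first exact: mulr_gt0.
move=> y; rewrite /ball/= => xy.
by rewrite (le_lt_trans (ramp_lip _ _))// ltr_pdivrMl.
Qed.

End ramp.

(** * The Gaussian distribution function and Gaussian means of ramps *)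

Definition gauss_cdf x := \int[mu]_(t in `]-oo, x]) phi t.

(** The density is at most 1. This prices the shift of the threshold by the width of a ramp. *)
Lemma gauss_cdf_lip x y : x <= y -> gauss_cdf y <= gauss_cdf x + (y - x).
Proof.
move=> xy; rewrite -lerBlDl /gauss_cdf.
rewrite Rintegral_itvB ?bnd_simp//; last exact: integrableS_itv integrable_phi.
have muxy : mu `]x, y] = (y - x)%:E.
  by rewrite lebesgue_measure_itv/= lte_fin; case: ltgtP xy => // ->; rewrite subrr.
apply: le_trans (_ : \int[mu]_(t in `]x, y]) (1 : R) <= _).
  apply: le_Rintegral => //.
  - exact: integrableS_itv integrable_phi.
  - apply: (@integrableS _ _ _ mu `[x, y]) => //; first exact: subset_itv_oc_cc.
    apply: continuous_compact_integrable; first exact: segment_compact.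
    by apply: continuous_subspaceT => t; exact: cvg_cst.
  - by move=> t _; exact: phi_le1.
by rewrite Rintegral_cst// mul1r [X in fine X <= _]muxy.
Qed.

Section ramp_mean.
Variables x0 e : R.
Hypothesis e0 : 0 < e.

Definition ramp_mean := \int[mu]_x (ramp x0 e x * phi x).

Let ramp_phi : mu.-integrable setT (EFin \o (fun x => ramp x0 e x * phi x)).
Proof.
apply: (@integrable_mul_phi _ 1); first exact: continuous_ramp.
by move=> x; rewrite ger0_norm ?ramp_ge0// ramp_le1.
Qed.

Let ramp_mean_split x : ramp_mean = \int[mu]_(t in `]-oo, x]) (ramp x0 e t * phi t)
  + \int[mu]_(t in `]x, +oo[) (ramp x0 e t * phi t).
Proof.
rewrite -(@Rintegral_itvB _ _ -oo%O +oo%O)//=; last exact: integrableS_itv.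
by rewrite set_itvNyy addrC subrK.
Qed.

(** Cut at [x0]: the ramp is 1 to the left and nonnegative to the right. *)
Lemma gauss_cdf_le_ramp_mean : gauss_cdf x0 <= ramp_mean.
Proof.
rewrite (ramp_mean_split x0) -[leLHS]addr0 lerD//.
  rewrite le_eqVlt; apply/orP; left; apply/eqP.
  apply: eq_Rintegral => t; rewrite inE/= in_itv/= => tx0.
  by rewrite ramp1// mul1r.
by apply: Rintegral_ge0 => t _; rewrite mulr_ge0 ?ramp_ge0// ltW// phi_gt0.
Qed.

(** Cut at [x0 + e]: the ramp is at most 1 to the left and 0 to the right. *)
Lemma ramp_mean_le_gauss_cdf : ramp_mean <= gauss_cdf (x0 + e).
Proof.
rewrite (ramp_mean_split (x0 + e)) -[leRHS]addr0 lerD//.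
  apply: le_Rintegral => //; first exact: integrableS_itv.
    exact: integrableS_itv integrable_phi.
  by move=> t _; rewrite ler_piMl ?ramp_le1// ltW// phi_gt0.
rewrite (@eq_Rintegral _ _ _ _ _ (cst 0)) ?Rintegral_cst ?mul0r// => t.
by rewrite inE/= in_itv/= andbT => /ltW xt; rewrite ramp0// mul0r.
Qed.

Lemma ramp_mean_itv : 0 <= ramp_mean <= 1.
Proof.
apply/andP; split.
  by apply: Rintegral_ge0 => t _; rewrite mulr_ge0 ?ramp_ge0// ltW// phi_gt0.
rewrite -Rintegral_phi; apply: le_Rintegral => //; first exact: integrable_phi.
by move=> t _; rewrite ler_piMl ?ramp_le1// ltW// phi_gt0.
Qed.

(** The derivative is expressed through the Stein equation itself; the three properties are those
    that the chain rule [gradient_comp] and the bound [stein_bound] require of a test function. *)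
Lemma stein_ramp : exists f : R -> R,
  [/\ continuous f, forall x, `|x * f x + (ramp x0 e x - ramp_mean)| <= 2 &
   forall M : R, exists C : R, forall x y, `|x| <= M -> `|y| <= M ->
     `|f y - f x - (x * f x + (ramp x0 e x - ramp_mean)) * (y - x)|
       <= C * (y - x) ^+ 2].
Proof.
pose k x := ramp x0 e x - ramp_mean.
have ck : continuous k.
  by move=> x; apply: cvgB; [exact: continuous_ramp|exact: cvg_cst].
have k1 x : `|k x| <= 1.
  have /andP[? ?] := ramp_mean_itv.
  by rewrite /k ler_norml; have := ramp_ge0 x0 e x; have := ramp_le1 x0 e x; lra.
have k0 : \int[mu]_x (k x * phi x) = 0.
  rewrite /k; under eq_Rintegral do rewrite mulrBl.
  have im : mu.-integrable setT (EFin \o (fun x => ramp_mean * phi x)).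
    by apply: (integrableZl _ _ integrable_phi).
  rewrite RintegralB// RintegralZl//; last exact: integrable_phi.
  by rewrite Rintegral_phi mulr1 subrr.
have kL : exists L : R, forall x y, `|k x - k y| <= L * `|x - y|.
  by exists e^-1 => x y; rewrite /k opprB addrA subrK; exact: ramp_lip.
exists (stein_sol k); split.
- exact: continuous_stein_sol.
- exact: stein_sol_deriv_le2.
- exact: stein_sol_taylor.
Qed.

End ramp_mean.
End gauss.

(** * Topology of the unitary group *)

Section topology.
Context {R : realType} {n : nat}.
Notation U := (unitary R n).
Notation C := (R[i] : numClosedFieldType).

Lemma continuous_mx (X : topologicalType) (T : topologicalType) m p
    (f : X -> 'M[T]_(m, p)) :
  (forall i j, continuous (fun x => f x i j)) -> continuous f.
Proof.
move=> cf x A [P MP PA].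
have : \forall y \near x, forall i j, P i j (f y i j).
  apply: filter_forall => i; apply: filter_forall => j; exact: cf (MP i j).
by apply: filterS => y Py; exact: PA.
Qed.

Lemma continuous_val : continuous (val : U -> 'M[R[i]]_n).
Proof. exact: initial_continuous. Qed.

Lemma continuous_entry i j : continuous (fun g : U => val g i j).
Proof.
move=> g; apply: (@continuous_comp _ _ _ (val : U -> 'M[R[i]]_n) (fun M => M i j)).
  exact: continuous_val.
(* Neighbourhoods of a matrix contain boxes of entrywise neighbourhoods; this box constrains the
   entry [(i, j)] only. *)
move=> A MA; exists (fun k l => if (k == i) && (l == j) then A else setT).
  move=> k l /=; case: andP => [[/eqP-> /eqP->]//|_]; exact: filterT.
by move=> M /= /(_ i j); rewrite !eqxx.
Qed.

(** The entries of [h * g] are linear in those of [g]. Continuity is what makes left translation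
    Borel measurable. *)
Lemma continuous_lmul (h : U) : continuous (fun g : U => (h * g)%g).
Proof.
apply: continuous_comp_initial; apply: continuous_mx => i j.
have -> : (fun g : U => (val \o (fun g : U => (h * g)%g)) g i j) =
  (fun g => \sum_k val h i k * val g k j).
  by apply/funext => g /=; rewrite mxE.
have ck k : continuous (fun g : U => val h i k * val g k j).
  move=> g.
  apply: (@cvgM C U (nbhs g) _ (fun _ => val h i k) (fun g => val g k j)).
    exact: cvg_cst.
  exact: continuous_entry.
apply: continuous_big => [|k _]; last exact: ck.
exact: (@pseudometric_normed_Zmodule.add_continuous _ C^o).
Qed.

Lemma continuous_Re : continuous (@complex.Re R).
Proof.
move=> z; apply/(@cvgrPdist_lt _ _ _ (nbhs (z : C)) (nbhs_filter _)) => e e0.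
apply/nbhs_ballP.
exists (e%:C); first by rewrite /= ltcR.
move=> w; rewrite /ball/= => zw; rewrite -ltcR; apply: le_lt_trans zw.
by rewrite -raddfB; exact: normc_ge_Re.
Qed.

Lemma continuous_Im : continuous (@complex.Im R).
Proof.
have -> : @complex.Im R = fun z => complex.Re (- 'i * z)%C.
  by apply/funext => -[a b] /=; simpc.
move=> z; apply: (@continuous_comp _ _ _ (fun z : R[i] => - 'i * z)%C).
  by apply: (@cvgM C _ (nbhs (z : C)) _ (fun _ => - 'i%C)); [exact: cvg_cst|exact: cvg_id].
exact: continuous_Re.
Qed.

End topology.

(** * Means of bounded complex functions *)

Section abs1.
Context {R : realType}.
Notation Re := (@complex.Re R).
Notation Im := (@complex.Im R).
Implicit Types z w : R[i].

(** The l1 norm on the complex plane: unlike the modulus on [R[i]] it takes values in [R], and it is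
    still subadditive and submultiplicative. *)
Definition abs1 z : R := `|Re z| + `|Im z|.

Lemma abs1_ge0 z : 0 <= abs1 z. Proof. exact: addr_ge0. Qed.

Lemma cReD z w : Re (z + w) = Re z + Re w. Proof. by case: z w => [? ?] []. Qed.
Lemma cImD z w : Im (z + w) = Im z + Im w. Proof. by case: z w => [? ?] []. Qed.
Lemma cReM z w : Re (z * w) = Re z * Re w - Im z * Im w.
Proof. by case: z w => [? ?] []. Qed.
Lemma cImM z w : Im (z * w) = Re z * Im w + Im z * Re w.
Proof. by case: z w => [? ?] []. Qed.
Lemma cReJ z : Re (Num.conj z) = Re z. Proof. by case: z. Qed.
Lemma cImJ z : Im (Num.conj z) = - Im z. Proof. by case: z. Qed.
Lemma cReN z : Re (- z) = - Re z. Proof. by case: z. Qed.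
Lemma cImN z : Im (- z) = - Im z. Proof. by case: z. Qed.

Lemma cRe_sum (I : Type) (r : seq I) (F : I -> R[i]) :
  Re (\sum_(i <- r) F i) = \sum_(i <- r) Re (F i).
Proof. exact: (big_morph Re cReD). Qed.

Lemma abs1D z w : abs1 (z + w) <= abs1 z + abs1 w.
Proof. by rewrite /abs1 cReD cImD addrACA lerD// ler_normD. Qed.

Lemma abs1N z : abs1 (- z) = abs1 z.
Proof. by rewrite /abs1 cReN cImN !normrN. Qed.

Lemma abs1J z : abs1 (Num.conj z) = abs1 z.
Proof. by rewrite /abs1 cReJ cImJ normrN. Qed.

Lemma abs1M z w : abs1 (z * w) <= abs1 z * abs1 w.
Proof.
rewrite /abs1 cReM cImM.
apply: (le_trans (lerD (ler_normB _ _) (ler_normD _ _))).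
by rewrite !normrM le_eqVlt; apply/orP; left; apply/eqP; ring.
Qed.

Lemma abs1R (a : R) : abs1 a%:C = `|a|.
Proof. by rewrite /abs1 normr0 addr0. Qed.

Lemma abs1_eq0 z : abs1 z <= 0 -> z = 0.
Proof.
rewrite /abs1; case: z => a b /= ab.
have a0 : `|a| = 0 by have := normr_ge0 a; have := normr_ge0 b; lra.
have b0 : `|b| = 0 by have := normr_ge0 a; have := normr_ge0 b; lra.
by rewrite (normr0_eq0 a0) (normr0_eq0 b0).
Qed.

Lemma complex_ext z w : Re z = Re w -> Im z = Im w -> z = w.
Proof. by case: z w => a b [c d] /= -> ->. Qed.

End abs1.

Section expectation.
Context {d} {T : measurableType d} {R : realType} (P : probability T R).
Notation Re := (@complex.Re R).
Notation Im := (@complex.Im R).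
Implicit Types F G : T -> R[i].

(** Bounded measurable functions form an algebra stable under conjugation, all of whose members are
    integrable; every function on the group met below belongs to it. *)
Definition bmfun F := [/\ measurable_fun setT (fun x => Re (F x)),
  measurable_fun setT (fun x => Im (F x)) &
  exists M : R, forall x, abs1 (F x) <= M].

Lemma eq_bmfun F G : F =1 G -> bmfun F -> bmfun G.
Proof. by move=> /funext ->. Qed.

Lemma bmfun_cst c : bmfun (fun=> c).
Proof. by split; [exact: measurable_cst|exact: measurable_cst|exists (abs1 c)]. Qed.

Lemma bmfunD F G : bmfun F -> bmfun G -> bmfun (fun x => F x + G x).
Proof.
move=> [rF iF [M FM]] [rG iG [N GN]]; split.
- by under eq_fun do rewrite cReD; exact: measurable_funD.
- by under eq_fun do rewrite cImD; exact: measurable_funD.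
- by exists (M + N) => x; rewrite (le_trans (abs1D _ _))// lerD.
Qed.

Lemma bmfunN F : bmfun F -> bmfun (fun x => - F x).
Proof.
move=> [rF iF [M FM]]; split.
- by under eq_fun do rewrite cReN; exact: measurableT_comp.
- by under eq_fun do rewrite cImN; exact: measurableT_comp.
- by exists M => x; rewrite abs1N.
Qed.

Lemma bmfunM F G : bmfun F -> bmfun G -> bmfun (fun x => F x * G x).
Proof.
move=> [rF iF [M FM]] [rG iG [N GN]]; split.
- by under eq_fun do rewrite cReM; apply: measurable_funB; exact: measurable_funM.
- by under eq_fun do rewrite cImM; apply: measurable_funD; exact: measurable_funM.
- exists (M * N) => x; rewrite (le_trans (abs1M _ _))//.
  by rewrite ler_pM ?abs1_ge0.
Qed.

Lemma bmfunJ F : bmfun F -> bmfun (fun x => Num.conj (F x)).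
Proof.
move=> [rF iF [M FM]]; split.
- by under eq_fun do rewrite cReJ.
- by under eq_fun do rewrite cImJ; exact: measurableT_comp.
- by exists M => x; rewrite abs1J.
Qed.

Lemma bmfun_sum (I : Type) (r : seq I) (F : I -> T -> R[i]) :
  (forall i, bmfun (F i)) -> bmfun (fun x => \sum_(i <- r) F i x).
Proof.
move=> bF; elim: r => [|i r IH].
  by apply: eq_bmfun (bmfun_cst 0) => x; rewrite big_nil.
by apply: eq_bmfun (bmfunD (bF i) IH) => x; rewrite big_cons.
Qed.

Lemma bmfunR (f : T -> R) (M : R) : measurable_fun setT f ->
  (forall x, `|f x| <= M) -> bmfun (fun x => (f x)%:C).
Proof.
move=> mf fM; split; [exact: mf|exact: (measurable_cst (0 : R))|].
by exists M => x; rewrite abs1R.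
Qed.

Lemma integrable_bounded_mfun (f : T -> R) (M : R) : measurable_fun setT f ->
  (forall x, `|f x| <= M) -> P.-integrable setT (EFin \o f).
Proof.
move=> mf fM; apply: measurable_bounded_integrable => //.
  exact: (@fin_num_fun_lty _ _ _ P).
exists M; split; first exact: num_real.
by move=> N MN x _ /=; rewrite (le_trans (fM x))// ltW.
Qed.

Lemma integrable_Re F : bmfun F -> P.-integrable setT (EFin \o (fun x => Re (F x))).
Proof.
move=> [rF _ [M FM]]; apply: (@integrable_bounded_mfun _ M) => // x.
by apply: le_trans (FM x); rewrite lerDl.
Qed.

Lemma integrable_Im F : bmfun F -> P.-integrable setT (EFin \o (fun x => Im (F x))).
Proof.
move=> [_ iF [M FM]]; apply: (@integrable_bounded_mfun _ M) => // x.
by apply: le_trans (FM x); rewrite lerDr.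
Qed.

Definition cmean F : R[i] := (\int[P]_x Re (F x)) +i* (\int[P]_x Im (F x)).

Lemma eq_cmean F G : F =1 G -> cmean F = cmean G.
Proof. by move=> /funext ->. Qed.

Lemma cmeanD F G : bmfun F -> bmfun G -> cmean (fun x => F x + G x) = cmean F + cmean G.
Proof.
move=> bF bG; apply: complex_ext => /=.
- under eq_Rintegral do rewrite cReD; rewrite RintegralD//; exact: integrable_Re.
- under eq_Rintegral do rewrite cImD; rewrite RintegralD//; exact: integrable_Im.
Qed.

Lemma cmeanZ c F : bmfun F -> cmean (fun x => c * F x) = c * cmean F.
Proof.
move=> bF; have rF := integrable_Re bF; have iF := integrable_Im bF.
have Z (a : R) (f : T -> R) : P.-integrable setT (EFin \o f) ->
    P.-integrable setT (EFin \o (fun x => a * f x)).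
  by move=> intf; apply: (integrableZl _ _ intf).
apply: complex_ext; rewrite /= ?cReM ?cImM /=.
- under eq_Rintegral do rewrite cReM.
  by rewrite RintegralB ?RintegralZl//; exact: Z.
- under eq_Rintegral do rewrite cImM.
  by rewrite RintegralD ?RintegralZl//; exact: Z.
Qed.

Lemma Rintegral_probability_cst (a : R) : \int[P]_x a = a.
Proof.
rewrite Rintegral_cst//.
by rewrite (_ : fine _ = 1) ?mulr1//; have /(congr1 fine) := probability_setT P.
Qed.

Lemma cmean_cst c : cmean (fun=> c) = c.
Proof.
by rewrite /cmean !Rintegral_probability_cst; case: c.
Qed.

Lemma cmeanJ F : bmfun F -> cmean (fun x => Num.conj (F x)) = Num.conj (cmean F).
Proof.
move=> bF; apply: complex_ext; rewrite ?cReJ ?cImJ /=.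
- by under eq_Rintegral do rewrite cReJ.
- under eq_Rintegral do rewrite cImJ -mulN1r.
  by rewrite RintegralZl ?mulN1r//; exact: integrable_Im.
Qed.

Lemma cmean_sum (I : Type) (r : seq I) (F : I -> T -> R[i]) :
  (forall i, bmfun (F i)) ->
  cmean (fun x => \sum_(i <- r) F i x) = \sum_(i <- r) cmean (F i).
Proof.
move=> bF; elim: r => [|i r IH].
  by rewrite big_nil -[RHS]cmean_cst; apply: eq_cmean => x; rewrite big_nil.
rewrite big_cons -IH -cmeanD//; last exact: bmfun_sum.
by apply: eq_cmean => x; rewrite big_cons.
Qed.

(** Each of the two components has mean at most [M] in absolute value. The lost factor is harmless
    where [M] is of order [t ^+ 2]. *)
Lemma cmean_le F (M : R) : bmfun F -> (forall x, abs1 (F x) <= M) ->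
  abs1 (cmean F) <= M + M.
Proof.
move=> bF FM.
have H (f : T -> R) : P.-integrable setT (EFin \o f) -> (forall x, `|f x| <= M) ->
    `|\int[P]_x f x| <= M.
  move=> intf fM; apply: (le_trans (le_normr_Rintegral _ _)) => //.
  rewrite -[leRHS]Rintegral_probability_cst.
  apply: le_Rintegral => //; first exact: integrable_norm.
  exact: finite_measure_integrable_cst.
rewrite /cmean /abs1 lerD//=; apply: H.
- exact: integrable_Re.
- by move=> x; apply: le_trans (FM x); rewrite lerDl.
- exact: integrable_Im.
- by move=> x; apply: le_trans (FM x); rewrite lerDr.
Qed.

End expectation.

(** * One-parameter deformations in the unitary group *)

Section path.
Context {R : realType} {n : nat}.
Notation U := (unitary R n).
Notation Re := (@complex.Re R).
Notation Im := (@complex.Im R).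

(* 1 + s * upath_coef s t, the eigenvalue of upath v t at v when s = v* v, is
   the Cayley transform (1 + i t s / 2) / (1 - i t s / 2). *)
Definition upath_coef (s t : R) : R[i] :=
  let a := t * s / 2 in (- (t * a) / (1 + a ^+ 2)) +i* (t / (1 + a ^+ 2)).

(** This is unitarity of [1 + c P] for Hermitian [P] with [P^2 = s P]: the left side is the
    coefficient of [P] in the product of [1 + c P] with its adjoint. *)
Lemma upath_coefE s t : let c := upath_coef s t in
  c + Num.conj c + c * Num.conj c * s%:C = 0.
Proof.
set a := t * s / 2.
have a0 : 1 + a ^+ 2 != 0 by rewrite gt_eqF// ltr_wpDr ?sqr_ge0.
apply: complex_ext; rewrite !(cReD, cImD, cReM, cImM, cReJ, cImJ) /=; last by ring.
rewrite -/a; rewrite /a in a0 *; field.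
by move: a0; apply: contra => /eqP H; apply/eqP; move: H; lra.
Qed.

(** With [a = t s / 2], the components of the difference are [- t a / (1 + a^2)] and
    [- t a^2 / (1 + a^2)]; each is at most [|t a|], half of the bound. *)
Lemma upath_coef_approx s t : abs1 (upath_coef s t - 'i%C * t%:C) <= `|s| * t ^+ 2.
Proof.
have a2 : 1 <= 1 + (t * s / 2) ^+ 2 by rewrite lerDl sqr_ge0.
rewrite /upath_coef; set a := t * s / 2 in a2 *.
have a0 : 1 + a ^+ 2 != 0 by rewrite gt_eqF// (lt_le_trans _ a2).
have -> : `|s| * t ^+ 2 = `|t * a| + `|t * a|.
  rewrite -[t ^+ 2]real_normK ?num_real// /a !normrM normfV.
  by rewrite (ger0_norm (ler0n R 2)); field.
have aa : `|a ^+ 2 / (1 + a ^+ 2)| <= `|a|.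
  rewrite normrM normfV (ger0_norm (le_trans ler01 a2)).
  rewrite ler_pdivrMr ?(lt_le_trans ltr01 a2)//.
  rewrite normrX -[a ^+ 2]real_normK ?num_real//.
  (* Completing the square in [a^2 - |a| + 1]. *)
  rewrite -subr_ge0 (_ : _ - _ = `|a| * ((`|a| - 1 / 2) ^+ 2 + 3 / 4)); last by field.
  by rewrite mulr_ge0// addr_ge0 ?sqr_ge0.
rewrite /abs1 lerD//.
- rewrite (_ : Re _ = - (t * a) / (1 + a ^+ 2)); last by simpc => /=; ring.
  rewrite normrM normfV normrN (ger0_norm (le_trans ler01 a2)).
  by rewrite ler_piMr// invf_le1// (lt_le_trans _ a2).
- rewrite (_ : Im _ = - (t * (a ^+ 2 / (1 + a ^+ 2)))); last by simpc => /=; field.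
  by rewrite normrN normrM [leRHS]normrM ler_wpM2l.
Qed.

Definition rank1 (v : 'cV[R[i]]_n) : 'M[R[i]]_n := v *m v^t*.

Definition sqnorm (v : 'cV[R[i]]_n) : R := Re ((v^t* *m v) 0 0).

Lemma sqnormE v : v^t* *m v = ((sqnorm v)%:C)%:M.
Proof.
apply/matrixP => i j; rewrite !ord1 [RHS]mxE mulr1n /sqnorm.
apply: complex_ext => //=.
suff : Num.conj ((v^t* *m v) 0 0) = (v^t* *m v) 0 0.
  by move/(congr1 Im); rewrite cImJ; lra.
rewrite mxE rmorph_sum; apply: eq_bigr => k _.
by rewrite !mxE rmorphM /= conjCK mulrC.
Qed.

Lemma rank1_sqr v : rank1 v *m rank1 v = (sqnorm v)%:C *: rank1 v.
Proof.
by rewrite /rank1 mulmxA -(mulmxA v) sqnormE mul_mx_scalar scalemxAl.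
Qed.

Lemma rank1_adj v : (rank1 v)^t* = rank1 v.
Proof. by rewrite /rank1 trmx_mul map_mxM trmxCK. Qed.

Fact upath_subproof v t :
  1%:M + upath_coef (sqnorm v) t *: rank1 v \is unitarymx.
Proof.
apply/unitarymxP; set c := upath_coef _ _.
have -> : (1%:M + c *: rank1 v)^t* = 1%:M + Num.conj c *: rank1 v.
  by rewrite linearD /= trmx1 map_mxD map_mx1 linearZ /= map_mxZ rank1_adj.
rewrite mulmxDl mul1mx mulmxDr mulmx1 -scalemxAl -scalemxAr rank1_sqr !scalerA.
rewrite -addrA -!scalerDl addrCA addrA.
rewrite (_ : _ + _ + _ = c + Num.conj c + c * Num.conj c * (sqnorm v)%:C).
  by rewrite upath_coefE scale0r addr0.
by ring.
Qed.

Definition upath v t : U :=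
  Sub (1%:M + upath_coef (sqnorm v) t *: rank1 v) (upath_subproof v t).

Lemma upath_mulE v t (g : U) : val (upath v t * g)%g =
  val g + upath_coef (sqnorm v) t *: (rank1 v *m val g).
Proof. by rewrite /= mulmxDl mul1mx scalemxAl. Qed.

End path.

(** * Gradients of functions on the unitary group *)

Section calculus.
Context {R : realType} {n : nat}.
Notation U := (unitary R n).
Notation T := (borelType U).
Notation Re := (@complex.Re R).
Notation Im := (@complex.Im R).
Implicit Types (F : U -> R[i]) (G : U -> 'M[R[i]]_n).

Lemma measurable_continuous_unitary (f : U -> R) : continuous f ->
  measurable_fun setT (f : T -> R).
Proof.
move=> cf; apply: (measurability _ (RGenOpens.measurableE R)).
move=> _ [_ [a [b ->]] <-]; rewrite setTI; apply: sub_sigma_algebra.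
by move/continuousP: cf; apply; exact: interval_open.
Qed.

Lemma measurable_lmul (h : U) : measurable_fun setT ((fun g => (h * g)%g) : T -> T).
Proof.
apply: (measurability _ (erefl : @measurable _ T = <<s @open U >>)).
move=> _ [A oA <-]; rewrite setTI; apply: sub_sigma_algebra.
by have /continuousP := @continuous_lmul R n h; apply.
Qed.

Lemma unitary_mulmxVr (g : U) : val g *m (val g)^t* = 1%:M.
Proof. exact/unitarymxP/(valP g). Qed.

Lemma unitary_mulmxVl (g : U) : (val g)^t* *m val g = 1%:M.
Proof. exact/mulmx1C/unitary_mulmxVr. Qed.

(** Rows have Euclidean norm 1, so the squares of the two components sum to at most 1. Only
    boundedness matters, and 2 is a convenient bound. *)
Lemma unitary_entry_le (g : U) i j : abs1 (val g i j) <= 2.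
Proof.
pose N k := Re (val g i k) ^+ 2 + Im (val g i k) ^+ 2.
have N0 k : 0 <= N k by rewrite addr_ge0 ?sqr_ge0.
have : \sum_k N k = 1.
  have /matrixP/(_ i i) := unitary_mulmxVr g; rewrite !mxE eqxx /=.
  move/(congr1 Re); rewrite cRe_sum => /= N1; rewrite -[RHS]N1; apply: eq_bigr => k _.
  by rewrite !mxE cReM cReJ cImJ /N; ring.
rewrite (bigD1 j)//= => sumN.
have : N j <= 1 by rewrite -sumN lerDl sumr_ge0.
rewrite /N /abs1 -(real_normK (num_real (Re _))) -(real_normK (num_real (Im _))).
move: `|_| `|_| => a b ab; have := sqr_ge0 (a - 1); have := sqr_ge0 (b - 1); lra.
Qed.

Lemma bmfun_entry i j : bmfun (fun g : T => val g i j).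
Proof.
have cij := @continuous_entry R n i j.
split.
- apply: measurable_continuous_unitary => g.
  by apply: continuous_comp; [exact: cij|exact: continuous_Re].
- apply: measurable_continuous_unitary => g.
  by apply: continuous_comp; [exact: cij|exact: continuous_Im].
- by exists 2 => g; exact: unitary_entry_le.
Qed.

Lemma mul_delta_mxE (A : 'M[R[i]]_n) (i j k l : 'I_n) :
  (A *m delta_mx i j) k l = A k i *+ (l == j).
Proof.
rewrite mxE (bigD1 i)//= mxE eqxx big1 ?addr0 => [|m mi].
  by rewrite mulr_natr.
by rewrite mxE (negbTE mi) mulr0.
Qed.

Lemma mxtrace_mul_delta (A : 'M[R[i]]_n) (i j : 'I_n) : \tr (A *m delta_mx j i) = A i j.
Proof.
rewrite /mxtrace (bigD1 i)//= mul_delta_mxE eqxx big1 ?addr0// => k ki.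
by rewrite mul_delta_mxE (negbTE ki).
Qed.

Lemma mxtrace_adj (A : 'M[R[i]]_n) : \tr (A^t*) = Num.conj (\tr A).
Proof. by rewrite trace_map_mx mxtrace_tr. Qed.

(* The derivative at t = 0 along upath v, whose velocity is 'i *: rank1 v, of a
   function with gradient G. *)
Definition dirder v (G : 'M[R[i]]_n) : R[i] := 'i%C * \tr (rank1 v *m G).

Lemma dirderZ v a (G : 'M[R[i]]_n) : dirder v (a *: G) = a * dirder v G.
Proof. by rewrite /dirder -scalemxAr mxtraceZ mulrCA. Qed.

(** The remainder is uniform in [g], so that it can be integrated; [t <= 1] lets higher powers of
    [t] be absorbed into [t ^+ 2]. *)
Definition path_diff v F (D : U -> R[i]) := exists K : R, forall (t : R) g,
  0 < t <= 1 -> abs1 (F (upath v t * g)%g - F g - t%:C * D g) <= K * t ^+ 2.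

(** [G] represents the derivative under left multiplication through the complex-linear pairing of
    [A] with [\tr (A *m G)]. Only the directions ['i *: rank1 v] are tested, which determine [G] by
    polarization. *)
Definition has_gradient F G := [/\ bmfun (F : T -> _),
  forall i j, bmfun (fun g : T => G g i j) &
  forall v, path_diff v F (fun g => dirder v (G g))].

Lemma bmfun_mulmx G (H : U -> 'M[R[i]]_n) :
  (forall i j, bmfun (fun g : T => G g i j)) ->
  (forall i j, bmfun (fun g : T => H g i j)) ->
  forall i j, bmfun (fun g : T => (G g *m H g) i j).
Proof.
move=> bG bH i j.
apply: (@eq_bmfun _ T _ (fun g => \sum_k G g i k * H g k j)) => [g|].
  by rewrite mxE.
by apply: bmfun_sum => k; exact: bmfunM.
Qed.

Lemma bmfun_mxtrace (G : U -> 'M[R[i]]_n) :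
  (forall i j, bmfun (fun g : T => G g i j)) ->
  bmfun (fun g : T => \tr (G g)).
Proof. by move=> bG; exact: bmfun_sum. Qed.

Lemma bmfun_dirder v G : (forall i j, bmfun (fun g : T => G g i j)) ->
  bmfun (fun g : T => dirder v (G g)).
Proof.
move=> bG; apply: bmfunM; first exact: bmfun_cst.
by apply: bmfun_mxtrace; apply: bmfun_mulmx => // i j; exact: bmfun_cst.
Qed.

Lemma eq_gradient F F' G G' : F =1 F' -> G =1 G' ->
  has_gradient F G -> has_gradient F' G'.
Proof. by move=> /funext -> /funext ->. Qed.

(** The derivative of [g_ij] along [A] is [(A g)_ij], the trace of [A g] times the matrix unit at
    [(j, i)]. *)
Lemma gradient_entry i j :
  has_gradient (fun g => val g i j) (fun g => val g *m delta_mx j i).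
Proof.
split; first exact: bmfun_entry.
  by apply: bmfun_mulmx => k l; [exact: bmfun_entry|exact: bmfun_cst].
move=> v.
have [_ _ [M MM]] : bmfun (fun g : T => (rank1 v *m val g) i j).
  by apply: bmfun_mulmx => k l; [exact: bmfun_cst|exact: bmfun_entry].
exists (`|sqnorm v| * M) => t g t01.
have E (A B : 'M[R[i]]_n) c : (A + c *: B) i j = A i j + c * B i j by rewrite !mxE.
rewrite upath_mulE E.
have -> : dirder v (val g *m delta_mx j i) = 'i%C * (rank1 v *m val g) i j.
  by rewrite /dirder mulmxA mxtrace_mul_delta.
set A := (rank1 v *m val g) i j; set c := upath_coef _ _.
rewrite (_ : _ - _ - _ = (c - 'i%C * t%:C) * A); last by ring.
rewrite (le_trans (abs1M _ _))// mulrAC ler_pM ?abs1_ge0//; last exact: MM.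
exact: upath_coef_approx.
Qed.

Lemma gradientD F F' G G' : has_gradient F G -> has_gradient F' G' ->
  has_gradient (fun g => F g + F' g) (fun g => G g + G' g).
Proof.
move=> [bF bG dF] [bF' bG' dF']; split; first exact: bmfunD.
  by move=> i j; under eq_fun do rewrite mxE; exact: bmfunD.
move=> v; have [K HK] := dF v; have [K' HK'] := dF' v.
exists (K + K') => t g t01; rewrite mulrDl.
apply: le_trans (lerD (HK t g t01) (HK' t g t01)).
rewrite (le_trans _ (abs1D _ _))//.
rewrite /dirder mulmxDr mxtraceD le_eqVlt; apply/orP; left; apply/eqP.
by congr abs1; ring.
Qed.

Lemma gradient_cst c : has_gradient (fun=> c) (fun=> 0).
Proof.
split; [exact: bmfun_cst|by move=> i j; under eq_fun do rewrite mxE; exact: bmfun_cst|].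
move=> v; exists 0 => t g _.
by rewrite /dirder mulmx0 mxtrace0 !mulr0 subrr subr0 mul0r /abs1 !normr0 addr0.
Qed.

Lemma gradientM F F' G G' : has_gradient F G -> has_gradient F' G' ->
  has_gradient (fun g => F g * F' g) (fun g => F g *: G' g + F' g *: G g).
Proof.
move=> [bF bG dF] [bF' bG' dF']; split; first exact: bmfunM.
  by move=> i j; under eq_fun do rewrite !mxE; apply: bmfunD; exact: bmfunM.
move=> v; have [K HK] := dF v; have [K' HK'] := dF' v.
have [_ _ [M HM]] := bF; have [_ _ [M' HM']] := bF'.
have [_ _ [N HN]] := bmfun_dirder v bG; have [_ _ [N' HN']] := bmfun_dirder v bG'.
(* The expansion at [t = 1] bounds a nonnegative quantity by [K]. *)
have K0 : 0 <= K.
  have := HK 1 1%g; rewrite expr1n mulr1 ltr01 lexx => /(_ isT).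
  by apply: le_trans; exact: abs1_ge0.
have K0' : 0 <= K'.
  have := HK' 1 1%g; rewrite expr1n mulr1 ltr01 lexx => /(_ isT).
  by apply: le_trans; exact: abs1_ge0.
(* One summand for each term of the decomposition of the remainder below; the middle one is a
   product of two increments, each of order [t]. *)
exists (K * M' + N * (K' + N') + M * K') => t g t01.
set D := dirder v (G g); set D' := dirder v (G' g).
have -> : dirder v (F g *: G' g + F' g *: G g) = F g * D' + F' g * D.
  by rewrite /D /D' /dirder mulmxDr -!scalemxAr mxtraceD !mxtraceZ; ring.
have DN : abs1 D <= N := HN g; have DN' : abs1 D' <= N' := HN' g.
set h := upath v t.
have [t0 t1] := andP t01.
have -> : F (h * g)%g * F' (h * g)%g - F g * F' g - t%:C * (F g * D' + F' g * D) =
  (F (h * g)%g - F g - t%:C * D) * F' (h * g)%g +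
  (t%:C * D) * ((F' (h * g)%g - F' g - t%:C * D') + t%:C * D') +
  F g * (F' (h * g)%g - F' g - t%:C * D') by ring.
have tN : abs1 (t%:C * D) <= t * N.
  by rewrite (le_trans (abs1M _ _))// abs1R gtr0_norm// ler_wpM2l// ltW.
have tN' : abs1 (t%:C * D') <= t * N'.
  by rewrite (le_trans (abs1M _ _))// abs1R gtr0_norm// ler_wpM2l// ltW.
apply: (le_trans (abs1D _ _)); rewrite [leRHS]mulrDl lerD//; last first.
  rewrite (le_trans (abs1M _ _))// -mulrA ler_pM ?abs1_ge0//; exact: HK'.
apply: (le_trans (abs1D _ _)); rewrite [leRHS]mulrDl lerD//.
  rewrite (le_trans (abs1M _ _))// mulrAC ler_pM ?abs1_ge0//; exact: HK.
rewrite (le_trans (abs1M _ _))//.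
have -> : N * (K' + N') * t ^+ 2 = (t * N) * ((K' + N') * t) by ring.
rewrite ler_pM ?abs1_ge0// (le_trans (abs1D _ _))// mulrDl lerD//; last first.
  by rewrite [leRHS]mulrC.
rewrite (le_trans (HK' t g t01))// ler_wpM2l//.
by rewrite expr2 ler_piMl// ltW.
Qed.

Lemma gradientZ c F G : has_gradient F G ->
  has_gradient (fun g => c * F g) (fun g => c *: G g).
Proof.
move=> dF; apply: eq_gradient (gradientM (gradient_cst c) dF) => // g.
by rewrite scaler0 addr0.
Qed.

Lemma gradient_sum (I : Type) (r : seq I) (F : I -> U -> R[i])
    (G : I -> U -> 'M[R[i]]_n) :
  (forall i, has_gradient (F i) (G i)) ->
  has_gradient (fun g => \sum_(i <- r) F i g) (fun g => \sum_(i <- r) G i g).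
Proof.
move=> dF; elim: r => [|i r IH].
  by apply: eq_gradient (gradient_cst 0) => g; rewrite big_nil.
by apply: eq_gradient (gradientD (dF i) IH) => g; rewrite big_cons.
Qed.

(** Conjugating ['i \tr (P G)] with [P] Hermitian replaces [G] by its adjoint; the sign is that of
    the conjugate of ['i]. *)
Lemma gradientJ F G : has_gradient F G ->
  has_gradient (fun g => Num.conj (F g)) (fun g => - (G g)^t*).
Proof.
move=> [bF bG dF]; split; first exact: bmfunJ.
  by move=> i j; under eq_fun do rewrite !mxE; apply: bmfunN; exact: bmfunJ.
move=> v; have [K HK] := dF v; exists K => t g t01.
rewrite (le_trans _ (HK t g t01))// -[leRHS]abs1J !rmorphB rmorphM /=.
suff -> : dirder v (- (G g)^t*) = Num.conj (dirder v (G g)).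
  by rewrite (_ : Num.conj t%:C = t%:C)//; apply: complex_ext; rewrite ?cReJ ?cImJ ?oppr0.
rewrite /dirder rmorphM /= mulmxN raddfN /= mulrN.
have -> : \tr (rank1 v *m (G g)^t*) = Num.conj (\tr (rank1 v *m G g)).
  by rewrite -mxtrace_adj trmx_mul map_mxM rank1_adj mxtrace_mulC.
rewrite -mulNr.
by congr (_ * _); apply: complex_ext; rewrite /= ?oppr0.
Qed.

(** Chain rule. As [w] is bounded, the expansion of [f] is needed on a bounded interval only. *)
Lemma gradient_comp (w : U -> R) (f f' : R -> R) G (B : R) :
  has_gradient (fun g => (w g)%:C) G -> continuous f -> continuous f' ->
  (forall x, `|f' x| <= B) ->
  (forall M : R, exists C : R, forall x y, `|x| <= M -> `|y| <= M ->
     `|f y - f x - f' x * (y - x)| <= C * (y - x) ^+ 2) ->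
  has_gradient (fun g => (f (w g))%:C) (fun g => (f' (w g))%:C *: G g).
Proof.
move=> [bw bG dw] cf cf' f'B fT.
have [mw _ [M HM]] := bw.
have {}mw : measurable_fun setT (w : T -> R) by exact: mw.
have {}HM g : `|w g| <= M by rewrite -abs1R.
have [C0 HC0] := fT M; pose C := `|C0|.
have Cge0 : 0 <= C := normr_ge0 _.
have HC x y : `|x| <= M -> `|y| <= M ->
    `|f y - f x - f' x * (y - x)| <= C * (y - x) ^+ 2.
  move=> xM yM; apply: (le_trans (HC0 x y xM yM)).
  by rewrite ler_wpM2r ?sqr_ge0// ler_norm.
have B0 : 0 <= B by apply: le_trans (f'B 0).
have M0 : 0 <= M by apply: le_trans (HM 1%g).
split.
(* Boundedness of [f] on [[-M, M]] is read off its expansion at 0. *)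
- apply: (@bmfunR _ _ _ _ (C * M ^+ 2 + `|f 0| + B * M)).
    by apply: measurableT_comp mw; exact: continuous_measurable_fun.
  move=> g; have := HC 0 (w g); rewrite normr0 subr0 => /(_ M0 (HM g)) H.
  rewrite (_ : f (w g) = (f (w g) - f 0 - f' 0 * w g) + f 0 + f' 0 * w g);
    last by ring.
  rewrite (le_trans (ler_normD _ _))// lerD//; last by rewrite normrM ler_pM.
  rewrite (le_trans (ler_normD _ _))// lerD// (le_trans H)//.
  by rewrite ler_wpM2l// -[leLHS]real_normK ?num_real// ler_sqr.
- move=> i j; under eq_fun do rewrite mxE; apply: bmfunM => //.
  apply: (@bmfunR _ _ _ _ B) => // .
  by apply: measurableT_comp mw; exact: continuous_measurable_fun.
move=> v; have [K HK] := dw v; have [_ _ [N HN]] := bmfun_dirder v bG.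
(* The increment of [w] is at most [(K + N) * t], which feeds the remainder of [f]; the remainder of
   [w] is multiplied by [f'], bounded by [B]. *)
exists (C * (K + N) ^+ 2 + B * K) => t g t01; have [t0 t1] := andP t01.
have {HK} := HK t g t01; have {HN} := HN g.
rewrite dirderZ.
set D := dirder v (G g) => DN; rewrite -rmorphB /=.
move: (w (upath v t * g)%g) (HM (upath v t * g)%g) => w' w'M HK.
have K0 : 0 <= K.
  by rewrite -(@pmulr_lge0 _ (t ^+ 2)) ?exprn_gt0//; apply: le_trans HK; exact: abs1_ge0.
have N0 : 0 <= N by apply: le_trans DN; exact: abs1_ge0.
have Dw : `|w' - w g| <= (K + N) * t.
  rewrite -abs1R -[(w' - w g)%:C](subrK (t%:C * D)).
  rewrite (le_trans (abs1D _ _))// mulrDl lerD//.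
    by rewrite (le_trans HK)// ler_wpM2l// expr2 ler_piMl// ltW.
  by rewrite (le_trans (abs1M _ _))// abs1R gtr0_norm// mulrC ler_wpM2r// ltW.
rewrite (_ : _ - _ = (f w' - f (w g) - f' (w g) * (w' - w g))%:C +
  (f' (w g))%:C * ((w' - w g)%:C - t%:C * D)); last first.
  by rewrite !(rmorphB, rmorphM) /=; ring.
rewrite (le_trans (abs1D _ _))// mulrDl lerD//.
  rewrite abs1R (le_trans (HC _ _ _ _))// -mulrA ler_wpM2l//.
  by rewrite -[leLHS]real_normK ?num_real// -exprMn ler_sqr// nnegrE//
    mulr_ge0 ?addr_ge0// ltW.
by rewrite (le_trans (abs1M _ _))// abs1R -mulrA ler_pM ?abs1_ge0.
Qed.

End calculus.

(** * Integration by parts for Haar measure *)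

Section haar_calculus.
Context {R : realType} {n : nat}.
Notation U := (unitary R n).
Notation T := (borelType U).
Notation Re := (@complex.Re R).
Notation Im := (@complex.Im R).
Implicit Types (F : U -> R[i]) (G : U -> 'M[R[i]]_n).

Variable haar : probability T R.
Hypothesis hhaar : is_haar haar.

Lemma haar_lmul (h : U) (f : T -> R) (M : R) :
  measurable_fun setT f -> (forall x, `|f x| <= M) ->
  \int[haar]_g f (h * g)%g = \int[haar]_g f g.
Proof.
move=> mf fM; have mh := measurable_lmul h.
(* The preimage of [A] under left multiplication by [h] is its translate by [h^-1], where invariance
   applies. *)
have pushE (A : set T) : measurable A -> A `<=` setT ->
    pushforward haar (fun g : T => (h * g)%g : T) A = haar A.
  move=> mA _; rewrite -(hhaar h^-1%g mA) /pushforward; congr (haar _).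
  apply/seteqP; split => [g /= Ahg|_ /= [g Ag <-]].
    by exists (h * g)%g => //; rewrite mulKg.
  by rewrite mulVKg.
rewrite /Rintegral; congr fine.
transitivity (\int[pushforward haar (fun g : T => (h * g)%g : T)]_g (f g)%:E)%E.
  rewrite integral_pushforward//=.
    exact/measurable_EFinP.
  apply: (@integrable_bounded_mfun _ _ _ _ _ M) => //.
  exact: (measurableT_comp mf mh).
exact: (@eq_measure_integral _ _ _ _ haar
  (measure_function_pushforward__canonical__measure_function_Measure haar mh)).
Qed.

Lemma cmean_lmul (h : U) F : bmfun (F : T -> _) ->
  cmean haar (fun g => F (h * g)%g) = cmean haar F.
Proof.
move=> [rF iF [M FM]]; apply: complex_ext => /=.
- apply: (@haar_lmul h (fun g => Re (F g)) M) => // g.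
  by apply: le_trans (FM g); rewrite lerDl.
- apply: (@haar_lmul h (fun g => Im (F g)) M) => // g.
  by apply: le_trans (FM g); rewrite lerDr.
Qed.


Notation E := (cmean haar).

(** By invariance the means of [F (upath v t * g)] and [F g] cancel, so [t] times the mean of the
    derivative is of order [t^2]; divide by [t] and let [t] tend to 0. *)
Lemma cmean_dirder v F G : has_gradient F G -> E (fun g => dirder v (G g)) = 0.
Proof.
move=> [bF bG dF]; have [K HK] := dF v.
set D := fun g => dirder v (G g).
have bD : bmfun (D : T -> _) by exact: bmfun_dirder.
have bl (t : R) : bmfun (fun g : T => F (upath v t * g)%g).
  have [rF iF [M FM]] := bF; split; last by exists M => g.
  - by apply: (measurableT_comp rF); exact: measurable_lmul.
  - by apply: (measurableT_comp iF); exact: measurable_lmul.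
have H (t : R) : 0 < t <= 1 -> abs1 (E D) <= (K + K) * t.
  move=> t01; have [t0 t1] := andP t01.
  have bN : bmfun (fun g : T => - F g) by exact: bmfunN.
  have btD : bmfun (fun g : T => (- t%:C) * D g) by apply: bmfunM => //; exact: bmfun_cst.
  have := @cmean_le _ _ _ haar _ (K * t ^+ 2) (bmfunD (bmfunD (bl t) bN) btD).
  rewrite cmeanD//; last exact: bmfunD.
  rewrite cmeanD// cmeanZ// cmean_lmul//.
  rewrite (_ : E (fun g => - F g) = - E F); last first.
    by rewrite -mulN1r -cmeanZ//; apply: eq_cmean => g; rewrite mulN1r.
  rewrite subrr add0r mulNr abs1N => Hle.
  have {}Hle : abs1 (t%:C * E D) <= K * t ^+ 2 + K * t ^+ 2.
    by apply: Hle => g; rewrite mulNr; exact: HK.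
  move: Hle.
  have -> : abs1 (t%:C * E D) = t * abs1 (E D).
    by rewrite /abs1 cReM cImM /= !mul0r subr0 addr0 !normrM gtr0_norm// mulrDr.
  by rewrite -mulrDl expr2 mulrA mulrC ler_pM2r.
apply/abs1_eq0; rewrite leNgt; apply/negP => E0.
have K0 : 0 < K + K.
  have := H 1; rewrite ltr01 lexx mulr1 => /(_ isT); exact: lt_le_trans.
(* This [t] makes [(K + K) * t] at most half of the supposedly positive left side. *)
pose t := Num.min 1 (abs1 (E D) / (K + K) / 2).
have tle : t <= abs1 (E D) / (K + K) / 2 by rewrite ge_min lexx orbT.
have t01 : 0 < t <= 1 by rewrite lt_min ltr01 !divr_gt0//= ge_min lexx.
have := le_trans (H t t01) (ler_wpM2l (ltW K0) tle).
rewrite mulrA mulrCA divff ?gt_eqF// mulr1; lra.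
Qed.

(** Polarization over the complex numbers: a sesquilinear form vanishing on the diagonal
    vanishes. *)
Lemma quadform_eq0 (m : 'M[R[i]]_n) : (forall v, \tr (rank1 v *m m) = 0) -> m = 0.
Proof.
move=> m0.
pose b (v w : 'cV[R[i]]_n) := \tr (v *m w^t* *m m).
have bD u v w : b (u + v) w = b u w + b v w.
  by rewrite /b mulmxDl mulmxDl mxtraceD.
have bDr u v w : b u (v + w) = b u v + b u w.
  by rewrite /b linearD /= map_mxD mulmxDr mulmxDl mxtraceD.
have bZ c v w : b (c *: v) w = c * b v w.
  by rewrite /b -!scalemxAl mxtraceZ.
have bZr c v w : b v (c *: w) = Num.conj c * b v w.
  by rewrite /b linearZ /= map_mxZ -scalemxAr -scalemxAl mxtraceZ.
have bvv v : b v v = 0 by exact: m0.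
have bC v w : b v w + b w v = 0.
  by have := bvv (v + w); rewrite bD !bDr !bvv add0r addr0.
(* Replacing [v] by ['i *: v] turns antisymmetry into symmetry, and both together force 0. *)
have b0 v w : b v w = 0.
  have := bC ('i%C *: v) w; rewrite bZ bZr.
  have -> : Num.conj ('i%C : R[i]) = - 'i%C by apply: complex_ext; rewrite /= ?oppr0.
  rewrite mulNr -mulrBr => /eqP; rewrite mulf_eq0 => /orP[/eqP/(congr1 Im)/=/eqP|].
    by rewrite oner_eq0.
  rewrite subr_eq0 => /eqP bE; have := bC v w; rewrite -bE -mulr2n => /eqP.
  by rewrite mulrn_eq0 => /eqP.
(* Basis vectors recover the entry: [b e_j e_i] is [m i j]. *)
apply/matrixP => i j; rewrite mxE -[RHS](b0 (delta_mx j 0) (delta_mx i 0)) /b.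
rewrite trmx_delta map_delta_mx mul_delta_mx mxtrace_mulC.
by rewrite mxtrace_mul_delta.
Qed.

(** By linearity the mean passes inside the trace, so the matrix of means has a vanishing quadratic
    form. *)
Lemma cmean_gradient F G : has_gradient F G -> forall i j, E (fun g => G g i j) = 0.
Proof.
move=> dF i j; have [_ bG _] := dF.
pose m := \matrix_(i, j) E (fun g => G g i j).
suff : m = 0 by move/matrixP/(_ i j); rewrite !mxE.
apply: quadform_eq0 => v; have := cmean_dirder v dF.
rewrite /dirder cmeanZ; last first.
  by apply: bmfun_mxtrace; apply: bmfun_mulmx => // k l; exact: bmfun_cst.
move/eqP; rewrite mulf_eq0 => /orP[/eqP/(congr1 Im)/=/eqP|/eqP <-].
  by rewrite oner_eq0.
rewrite /mxtrace cmean_sum; last first.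
  by move=> k; apply: bmfun_mulmx => // ? ?; exact: bmfun_cst.
apply: eq_bigr => k _; rewrite mxE.
under [RHS]eq_cmean do rewrite mxE.
rewrite cmean_sum; last by move=> l; apply: bmfunM => //; exact: bmfun_cst.
by apply: eq_bigr => l _; rewrite cmeanZ// !mxE.
Qed.

(* Sum over a of the mean of the (b, a) entry of the gradient of F g_ac. *)
Lemma schwinger_dyson F G : has_gradient F G -> forall b c,
  n%:R * E (fun g => F g * val g b c) + E (fun g => (G g *m val g) b c) = 0.
Proof.
move=> dF b c; have [bF bG _] := dF.
(* The first term is free of [a], so summing over [a] produces the factor [n]; the second assembles
   the product [G g]. *)
have H a : E (fun g => F g * val g b c) + E (fun g => G g b a * val g a c) = 0.
  have := cmean_gradient (gradientM dF (gradient_entry a c)) b a.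
  rewrite -cmeanD; last 2 first.
  - by apply: bmfunM => //; exact: bmfun_entry.
  - by apply: bmfunM => //; exact: bmfun_entry.
  move=> H; rewrite -[RHS]H; apply: eq_cmean => g.
  have lin (A B : 'M[R[i]]_n) x y : (x *: A + y *: B) b a = x * A b a + y * B b a.
    by rewrite !mxE.
  by rewrite lin mul_delta_mxE eqxx mulr1n; ring.
under [X in _ + X]eq_cmean do rewrite mxE.
rewrite cmean_sum; last by move=> l; apply: bmfunM => //; exact: bmfun_entry.
have -> : n%:R * E (fun g => F g * val g b c) =
    \sum_(a < n) E (fun g => F g * val g b c).
  by rewrite sumr_const card_ord mulr_natl.
by rewrite -big_split/= big1.
Qed.

Lemma schwinger_dyson_tr F G : has_gradient F G ->
  n%:R * E (fun g => F g * \tr (val g)) + E (fun g => \tr (G g *m val g)) = 0.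
Proof.
move=> dF; have [bF bG _] := dF.
have -> : E (fun g => F g * \tr (val g)) = \sum_b E (fun g => F g * val g b b).
  rewrite -cmean_sum; first by apply: eq_cmean => g; rewrite /mxtrace mulr_sumr.
  by move=> b; apply: bmfunM => //; exact: bmfun_entry.
rewrite mulr_sumr cmean_sum; last first.
  by move=> b; apply: bmfun_mulmx => //; exact: bmfun_entry.
by rewrite -big_split/= big1// => b _; exact: schwinger_dyson.
Qed.

End haar_calculus.

(** * Moments of power sums and the Stein identity *)

Section moments.
Context {R : realType} {n : nat}.
Hypothesis n2 : (2 <= n)%N.
Notation U := (unitary R n).
Notation T := (borelType U).
Notation Re := (@complex.Re R).
Notation Im := (@complex.Im R).
Variable haar : probability T R.
Hypothesis hhaar : is_haar haar.
Notation E := (cmean haar).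

Definition p1 (g : U) : R[i] := \tr (val g).
Definition p2 (g : U) : R[i] := \tr (val g *m val g).

Lemma gradient_p1 : has_gradient p1 val.
Proof.
apply: eq_gradient (gradient_sum (index_enum 'I_n)
  (fun i => gradient_entry i i)) => // g.
rewrite -mulmx_sumr (_ : \sum_i _ = 1%:M) ?mulmx1//.
by rewrite [RHS]matrix_sum_delta; apply: eq_bigr => i _;
  rewrite (bigD1 i)//= mxE eqxx scale1r big1 ?addr0// => j ji;
  rewrite mxE eq_sym (negbTE ji) scale0r.
Qed.

Lemma gradient_p2 : has_gradient p2 (fun g => 2 *: (val g *m val g)).
Proof.
apply: eq_gradient (gradient_sum (index_enum 'I_n) (fun i =>
  gradient_sum (index_enum 'I_n) 
    (fun j => gradientM (gradient_entry i j) (gradient_entry j i)))) => // g.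
  by rewrite /p2 /mxtrace; apply: eq_bigr => i _; rewrite mxE.
under eq_bigr do rewrite big_split/=.
(* The two halves of the product rule are this same sum, up to exchanging [i] and [j]. *)
have gg : \sum_i \sum_j val g i j *: (val g *m delta_mx i j) = val g *m val g.
  rewrite [X in _ = _ *m X](matrix_sum_delta (val g)) mulmx_sumr.
  apply: eq_bigr => i _; rewrite mulmx_sumr; apply: eq_bigr => j _.
  by rewrite scalemxAr.
by rewrite big_split/= scaler_nat mulr2n -{1}gg [X in _ + X = _]exchange_big/= gg.
Qed.

Lemma bmfun_p1 : bmfun (p1 : T -> _). Proof. by have [] := gradient_p1. Qed.
Lemma bmfun_p2 : bmfun (p2 : T -> _). Proof. by have [] := gradient_p2. Qed.

Let nR0 : (n%:R : R[i]) != 0.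
Proof. by rewrite pnatr_eq0 -lt0n (leq_trans _ n2). Qed.

(** For [F] the conjugate of [p1], the gradient is minus the adjoint of [g], so [G g = - 1] has
    trace [- n]. *)
Lemma moment_p1 : E (fun g => Num.conj (p1 g) * p1 g) = 1.
Proof.
have := schwinger_dyson_tr hhaar (gradientJ gradient_p1).
have -> : E (fun g : T => \tr (- (val g)^t* *m val g)) = - n%:R.
  rewrite -[RHS](cmean_cst haar); apply: eq_cmean => g.
  by rewrite mulNmx unitary_mulmxVl raddfN /= mxtrace1.
by move/eqP; rewrite subr_eq0 => /eqP H; apply: (mulfI nR0); rewrite H mulr1.
Qed.

Lemma adj_sqr_mul (g : U) : ((val g *m val g)^t*) *m val g = (val g)^t*.
Proof. by rewrite trmx_mul map_mxM -mulmxA unitary_mulmxVl mulmx1. Qed.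

(** The second moment [a] is coupled to the mixed moment [b]; the next two identities form a linear
    system in both. *)
Let a := E (fun g => Num.conj (p2 g) * p2 g).
Let b := E (fun g => Num.conj (p2 g) * (p1 g * p1 g)).

Lemma adjZ (c : R[i]) (A : 'M[R[i]]_n) : (c *: A)^t* = Num.conj c *: A^t*.
Proof. by rewrite linearZ /= map_mxZ. Qed.

Lemma conj_nat (m : nat) : Num.conj (m%:R : R[i]) = m%:R.
Proof. by rewrite rmorph_nat. Qed.

(* Schwinger-Dyson for conj(p2) g_ji, at the entry (i, j), summed over i, j. *)
Lemma moment_eq1 : n%:R * a + b = 2 * n%:R.
Proof.
pose Y (g : U) : 'M[R[i]]_n := - (2 *: (val g *m val g))^t*.
have YE (g : U) : Y g *m val g = - 2 *: (val g)^t*.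
  by rewrite /Y adjZ conj_nat mulNmx -scalemxAl adj_sqr_mul scaleNr.
pose G (i j : 'I_n) (g : U) : 'M[R[i]]_n :=
  Num.conj (p2 g) *: (val g *m delta_mx i j) + val g j i *: Y g.
have SD i j := schwinger_dyson hhaar
  (gradientM (gradientJ gradient_p2) (gradient_entry j i)) i j.
have bG i j : bmfun (fun g : T => (G i j g *m val g) i j).
  apply: bmfun_mulmx; last exact: bmfun_entry.
  by have [] := gradientM (gradientJ gradient_p2) (gradient_entry j i).
have bF i j : bmfun (fun g : T => Num.conj (p2 g) * val g j i * val g i j).
  by apply: bmfunM; [apply: bmfunM; [exact: bmfunJ bmfun_p2|]|]; exact: bmfun_entry.
have : \sum_i \sum_j (n%:R * E (fun g => Num.conj (p2 g) * val g j i * val g i j)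
    + E (fun g => (G i j g *m val g) i j)) = 0.
  by apply: big1 => i _; apply: big1 => j _; exact: SD.
under eq_bigr do rewrite big_split/= -mulr_sumr -!cmean_sum//.
rewrite big_split/= -mulr_sumr -!cmean_sum; last 2 first.
- by move=> i; exact: bmfun_sum.
- by move=> i; exact: bmfun_sum.
rewrite (eq_cmean haar (G := fun g => Num.conj (p2 g) * p2 g)) -/a; last first.
  move=> g; rewrite /p2 {2}/mxtrace mulr_sumr; apply: eq_bigr => i _.
  rewrite mxE mulr_sumr; apply: eq_bigr => j _.
  by rewrite -mulrA (mulrC (val g j i)).
rewrite (eq_cmean haar (G := fun g => Num.conj (p2 g) * (p1 g * p1 g) + - (2 * n%:R))).
  rewrite cmeanD; [|by apply: bmfunM;
    [exact: bmfunJ bmfun_p2|apply: bmfunM; exact: bmfun_p1]|exact: bmfun_cst].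
  by rewrite cmean_cst addrA => /eqP; rewrite subr_eq0 => /eqP.
move=> g.
have GE i j : (G i j g *m val g) i j = Num.conj (p2 g) * (val g i i * val g j j)
    - 2 * (val g j i * Num.conj (val g j i)).
  rewrite /G mulmxDl -!scalemxAl YE.
  have lin (A B : 'M[R[i]]_n) x y :
    (x *: A + y *: (- 2 *: B)) i j = x * A i j - 2 * (y * B i j).
    by rewrite !mxE; ring.
  rewrite lin !mxE; congr (_ * _ - _).
  rewrite (bigD1 j)//= mul_delta_mxE eqxx mulr1n big1 ?addr0// => k kj.
  by rewrite mul_delta_mxE (negbTE kj) mulr0n mul0r.
under eq_bigr do under eq_bigr do rewrite GE.
under eq_bigr do rewrite big_split/= -mulr_sumr.
rewrite big_split/= -mulr_sumr; congr (_ + _).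
  by congr (_ * _); rewrite /p1 /mxtrace mulr_suml; apply: eq_bigr => i _; rewrite mulr_sumr.
under eq_bigr do rewrite sumrN -mulr_sumr.
rewrite sumrN -mulr_sumr; congr (- (_ * _)).
(* The squared moduli of all entries sum to the trace of [g] times its adjoint, which is [n]. *)
rewrite -[RHS](mxtrace1 _ n) -(unitary_mulmxVr g) /mxtrace exchange_big/=.
by apply: eq_bigr => i _; rewrite mxE; apply: eq_bigr => j _; rewrite !mxE.
Qed.

(** Schwinger-Dyson for the conjugate of [p2] times [p1]: the trace of [G g] is [|p2|^2 - 2 |p1|^2],
    and [|p1|^2] has mean 1. *)
Lemma moment_eq2 : n%:R * b + a = 2.
Proof.
have := schwinger_dyson_tr hhaar (gradientM (gradientJ gradient_p2) gradient_p1).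
rewrite (eq_cmean haar (G := fun g => Num.conj (p2 g) * (p1 g * p1 g))) -/b; last first.
  by move=> g; rewrite mulrA.
rewrite (eq_cmean haar (G := fun g =>
    Num.conj (p2 g) * p2 g + (- 2) * (Num.conj (p1 g) * p1 g))).
  rewrite cmeanD; last 2 first.
  - by apply: bmfunM; [exact: bmfunJ bmfun_p2|exact: bmfun_p2].
  - apply: bmfunM; [exact: bmfun_cst|].
    by apply: bmfunM; [exact: bmfunJ bmfun_p1|exact: bmfun_p1].
  rewrite cmeanZ; last by apply: bmfunM; [exact: bmfunJ bmfun_p1|exact: bmfun_p1].
  by rewrite moment_p1 -/a mulr1 addrA => /eqP; rewrite subr_eq0 => /eqP.
move=> g; rewrite mulmxDl -!scalemxAl mxtraceD !mxtraceZ -/(p2 g).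
rewrite adjZ conj_nat mulNmx -scalemxAl adj_sqr_mul.
rewrite raddfN /= mxtraceZ mxtrace_adj -/(p1 g); ring.
Qed.

(** Eliminating [b] gives [(n^2 - 1) a = 2 (n^2 - 1)], where [n >= 2] permits cancellation. *)
Lemma moment_p2 : a = 2.
Proof.
have n1 : (n%:R ^+ 2 - 1 : R[i]) != 0.
  rewrite subr_eq0 -natrX -[1]/(1%:R) eqr_nat.
  by rewrite -[1%N]/(1 ^ 2)%N eqn_exp2r// gtn_eqF.
apply: (mulfI n1).
have -> : (n%:R ^+ 2 - 1) * a = n%:R * (n%:R * a + b) - (n%:R * b + a) by ring.
rewrite moment_eq1 moment_eq2; ring.
Qed.

(** The trace of the gradient of [p2^2] is [4 p2^2]: an infinitesimal form of invariance under
    multiplication by scalars of modulus 1. *)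
Lemma moment_p2_sqr : E (fun g => p2 g * p2 g) = 0.
Proof.
have d22 := gradientM gradient_p2 gradient_p2.
have [_ bG _] := d22.
have H : E (fun g => \tr (p2 g *: (2 *: (val g *m val g))
    + p2 g *: (2 *: (val g *m val g)))) = 0.
  rewrite cmean_sum; last by move=> i; exact: bG.
  by apply: big1 => i _; exact: (cmean_gradient hhaar d22).
have b22 : bmfun (fun g : T => p2 g * p2 g) by apply: bmfunM; exact: bmfun_p2.
apply: (mulfI (_ : 4 != 0 :> R[i])); first by rewrite pnatr_eq0.
rewrite mulr0 -cmeanZ// -H; apply: eq_cmean => g.
rewrite mxtraceD !mxtraceZ -/(p2 g); ring.
Qed.

(** Expand the square of the real part as [(z^2 + 2 |z|^2 + conj z^2) / 4]; only the middle term has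
    nonzero mean. *)
Lemma moment_Re_p2 : \int[haar]_g (Re (p2 g) ^+ 2) = 1.
Proof.
have b2 := bmfun_p2; have b2J := bmfunJ b2.
have : E (fun g => (Re (p2 g) ^+ 2)%:C) = 1.
  rewrite (eq_cmean haar (G := fun g => 4^-1 * (p2 g * p2 g)
    + (2^-1 * (Num.conj (p2 g) * p2 g)
    + 4^-1 * Num.conj (p2 g * p2 g)))).
    rewrite !cmeanD;
      try by repeat first
        [apply: bmfunD|apply: bmfunM|apply: bmfunJ|exact: bmfun_cst|exact: b2].
    rewrite !cmeanZ;
      try by repeat first
        [apply: bmfunD|apply: bmfunM|apply: bmfunJ|exact: bmfun_cst|exact: b2].
    rewrite cmeanJ; last by apply: bmfunM.
    rewrite moment_p2_sqr -/a moment_p2 rmorph0 !mulr0 add0r addr0 mulVf//.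
  move=> g; rewrite rmorphXn /= ReJ_add -[(p2 g)^*%C]/(Num.conj (p2 g)) rmorphM /=.
  by field.
by move/(congr1 Re).
Qed.

Let W : U -> R := @trace_stat R n.

Lemma trace_stat_p1 (g : U) :
  (W g)%:C = (sqrtC 2)^-1 * (p1 g + Num.conj (p1 g)).
Proof. exact: trace_statE. Qed.

Lemma gradient_trace_stat :
  has_gradient (fun g => (W g)%:C) (fun g => (sqrtC 2)^-1 *: (val g - (val g)^t*)).
Proof.
apply: eq_gradient (gradientZ (sqrtC 2)^-1
  (gradientD gradient_p1 (gradientJ gradient_p1))) => // g.
by rewrite trace_stat_p1.
Qed.

Lemma measurable_trace_stat : measurable_fun setT (W : T -> R).
Proof. by have [[]] := gradient_trace_stat. Qed.

(** * The Stein identity for the trace statistic and its error bound *)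

Section stein_identity.
Variables (f f' : R -> R).
Hypotheses (cf : continuous f) (cf' : continuous f').
Hypothesis f'_le2 : forall x, `|f' x| <= 2.
Hypothesis fT : forall M : R, exists C : R, forall x y, `|x| <= M -> `|y| <= M ->
     `|f y - f x - f' x * (y - x)| <= C * (y - x) ^+ 2.

Let dfW := gradient_comp gradient_trace_stat cf cf' f'_le2 fT.

Let bfW : bmfun (fun g : T => (f (W g))%:C). Proof. by have [] := dfW. Qed.

Let mf'W : measurable_fun setT (fun g : T => f' (W g)).
Proof. by apply: measurableT_comp measurable_trace_stat; exact: continuous_measurable_fun. Qed.

Let bf'W : bmfun (fun g : T => (f' (W g))%:C).
Proof. exact: (@bmfunR _ _ _ _ 2). Qed.

Let sr : Num.conj ((sqrtC 2)^-1 : R[i]) = (sqrtC 2)^-1.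
Proof. by rewrite conj_Creal// realV ger0_real// sqrtC_ge0 ler0n. Qed.

Let ss : ((sqrtC 2)^-1 * (sqrtC 2)^-1 : R[i]) = 2^-1.
Proof. by rewrite -invfM -expr2 sqrtCK. Qed.

(** Schwinger-Dyson for [f (W g)] evaluates the mean [X] of [f(W) p1]; adding the conjugate equation
    reconstitutes [W], and the two factors [1 / sqrt 2] combine to 1/2. *)
Lemma stein_identity :
  n%:R * \int[haar]_g (f' (W g) - W g * f (W g)) = \int[haar]_g (f' (W g) * Re (p2 g)).
Proof.
set s := (sqrtC 2)^-1 : R[i].
pose X := E (fun g => (f (W g))%:C * p1 g).
pose Y := E (fun g => (f' (W g))%:C * p2 g).
pose D := E (fun g => (f' (W g))%:C).
have bfp : bmfun (fun g : T => (f (W g))%:C * p1 g) by apply: bmfunM => //; exact: bmfun_p1.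
have bf'p : bmfun (fun g : T => (f' (W g))%:C * p2 g) by apply: bmfunM => //; exact: bmfun_p2.
have bWf : bmfun (fun g : T => (W g * f (W g))%:C).
  apply: (@eq_bmfun _ T _ (fun g : T => (W g)%:C * (f (W g))%:C)).
    by move=> g; rewrite rmorphM.
  by apply: bmfunM => //; have [] := gradient_trace_stat.
(* Here the trace of [G g] is [s f'(W) (p2 - n)], because [g] is unitary. *)
have XE : n%:R * X = s * (n%:R * D - Y).
  have := schwinger_dyson_tr hhaar dfW; rewrite -/X.
  rewrite (eq_cmean haar (G := fun g =>
    s * ((f' (W g))%:C * p2 g + (- n%:R) * (f' (W g))%:C))).
    rewrite cmeanZ; last by apply: bmfunD => //; apply: bmfunM => //; exact: bmfun_cst.
    rewrite cmeanD//; last by apply: bmfunM => //; exact: bmfun_cst.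
    by rewrite cmeanZ// -/Y -/D => /eqP; rewrite addr_eq0 => /eqP ->; ring.
  move=> g; rewrite -!scalemxAl !mxtraceZ mulmxBl unitary_mulmxVl.
  by rewrite raddfB /= mxtrace1 -/(p2 g) -/s; ring.
have WE : E (fun g => (W g * f (W g))%:C) = s * (X + Num.conj X).
  rewrite /X -cmeanJ// -cmeanD//; last exact: bmfunJ.
  rewrite -cmeanZ; last by apply: bmfunD => //; exact: bmfunJ.
  have fJ x : Num.conj (x%:C) = x%:C :> R[i].
    by apply: complex_ext; rewrite ?cReJ ?cImJ ?oppr0.
  by apply: eq_cmean => g; rewrite !rmorphM /= fJ trace_stat_p1 -/s; ring.
have DJ : Num.conj D = D.
  rewrite /D -cmeanJ//; apply: eq_cmean => g.
  by apply: complex_ext; rewrite ?cReJ ?cImJ ?oppr0.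
have key : n%:R * (D - E (fun g => (W g * f (W g))%:C)) = 2^-1 * (Y + Num.conj Y).
  have XJ : n%:R * Num.conj X = s * (n%:R * D - Num.conj Y).
    by rewrite -(conj_nat n) -rmorphM XE rmorphM rmorphB rmorphM /= conj_nat DJ sr.
  rewrite WE (_ : _ * _ = n%:R * D - s * (n%:R * X + n%:R * Num.conj X)); last by ring.
  rewrite XE XJ (_ : s * _ = (s * s) * (2 * (n%:R * D) - Y - Num.conj Y)); last by ring.
  by rewrite ss; field.
have half : 2^-1 * (Y + Num.conj Y) = (Re Y)%:C by rewrite ReJ_add mulrC.
rewrite half -(rmorph_nat (real_complex R)) in key.
have {key} := congr1 Re key.
rewrite cReM cReD cReN [complex.Im _%:C]/= mul0r subr0 /= => key.
rewrite RintegralB//; [|exact: integrable_Re bf'W|exact: integrable_Re bWf].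
rewrite key; apply: eq_Rintegral => g _.
by rewrite cReM /= mul0r subr0.
Qed.

(** The bound [2 |r| <= r^2 + 1] with [r = Re p2] replaces Cauchy-Schwarz; its right side has mean
    2. *)
Lemma stein_bound : `|\int[haar]_g (f' (W g) - W g * f (W g))| <= 2 / n%:R.
Proof.
have n0 : 0 < n%:R :> R by rewrite ltr0n (leq_trans _ n2).
have [rp2 _ [M HM]] := bmfun_p2.
have HM' g : `|Re (p2 g)| <= M by apply: le_trans (HM g); rewrite lerDl.
have ip : haar.-integrable setT (EFin \o (fun g => Re (p2 g) ^+ 2 + 1)).
  apply: (@integrable_bounded_mfun _ _ _ _ _ (M ^+ 2 + 1)).
    by apply: measurable_funD => //; exact: measurable_funX.
  move=> g; rewrite ger0_norm ?addr_ge0 ?sqr_ge0// lerD2r.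
  by rewrite -[leLHS]real_normK ?num_real// ler_sqr// nnegrE// (le_trans _ (HM' g)).
have if2 : haar.-integrable setT (EFin \o (fun g => f' (W g) * Re (p2 g))).
  apply: (@integrable_bounded_mfun _ _ _ _ _ (2 * M)); first exact: measurable_funM.
  by move=> g; rewrite normrM ler_pM.
rewrite ler_pdivlMr// mulrC -[X in X * _](gtr0_norm n0) -normrM stein_identity.
apply: (le_trans (le_normr_Rintegral _ if2)) => //.
have <- : \int[haar]_g (Re (p2 g) ^+ 2 + 1) = 2.
  rewrite RintegralD//.
  - by rewrite moment_Re_p2 Rintegral_probability_cst.
  - apply: (@integrable_bounded_mfun _ _ _ _ _ (M ^+ 2)); first exact: measurable_funX.
    move=> g; rewrite ger0_norm ?sqr_ge0//.
    by rewrite -[leLHS]real_normK ?num_real// ler_sqr// nnegrE// (le_trans _ (HM' g)).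
  - exact: finite_measure_integrable_cst.
apply: le_Rintegral => //; first exact: integrable_norm.
move=> g _; rewrite normrM (le_trans (ler_wpM2r _ (f'_le2 _)))//.
rewrite -[leRHS]/(_ ^+ 2 + 1) -[Re (p2 g) ^+ 2]real_normK ?num_real//.
by have := sqr_ge0 (`|Re (p2 g)| - 1); lra.
Qed.

End stein_identity.

(** * From ramps to the distribution function *)

Section ramp_bound.
Variables x0 e : R.
Hypothesis e0 : 0 < e.

Lemma ramp_stat_bound :
  `|\int[haar]_g ramp x0 e (W g) - ramp_mean x0 e| <= 2 / n%:R.
Proof.
have [f [cf f'2 fT]] := stein_ramp x0 e0.
pose f' x := x * f x + (ramp x0 e x - ramp_mean x0 e).
have cr := @continuous_ramp R x0 e e0.
have cf' : continuous f'.
  move=> x; apply: cvgD; first by apply: cvgM; [exact: cvg_id|exact: cf].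
  by apply: cvgB; [exact: cr|exact: cvg_cst].
have := stein_bound cf cf' f'2 fT.
have -> : \int[haar]_g (f' (W g) - W g * f (W g)) =
    \int[haar]_g (ramp x0 e (W g) - ramp_mean x0 e).
  by apply: eq_Rintegral => g _; rewrite /f' addrC addKr.
rewrite RintegralB//; last exact: finite_measure_integrable_cst.
  by rewrite Rintegral_probability_cst.
apply: (@integrable_bounded_mfun _ _ _ _ _ 1).
  by apply: measurableT_comp measurable_trace_stat; exact: continuous_measurable_fun.
by move=> g; rewrite ger0_norm ?ramp_ge0 ?ramp_le1.
Qed.

End ramp_bound.

Lemma gauss_cdfE (x : R) : gauss_cdf x =
  (Num.sqrt (2 * pi))^-1 * \int[lebesgue_measure]_(t in `]-oo, x]) expR (- (t ^+ 2 / 2)).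
Proof.
have c0 : Num.sqrt (2 * pi) != 0 :> R by rewrite sqrtr_eq0 -ltNge mulr_gt0 ?pi_gt0.
rewrite /gauss_cdf -RintegralZl//; first by apply: eq_Rintegral => t _; rewrite phiE.
apply: integrableS_itv.
have -> : (fun t : R => expR (- (t ^+ 2 / 2))) = (fun t => Num.sqrt (2 * pi) * phi t).
  by apply/funext => t; rewrite phiE mulVKf.
by apply: (integrableZl _ _ (@integrable_phi R)).
Qed.

(** The indicator of [W <= x0] lies between the ramps starting at [x0 - e] and at [x0]. Their
    Gaussian means are within [e] of [gauss_cdf x0] on the side needed, and [e] is arbitrary. *)
Lemma trace_stat_cdf_bound (x0 : R) :
  `|fine (haar [set g | W g <= x0]) - gauss_cdf x0| <= 2 / n%:R.
Proof.
set A := [set g : T | W g <= x0].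
have mA : measurable A.
  have -> : A = setT `&` W @^-1` `]-oo, x0].
    by rewrite setTI; apply/seteqP; split => g; rewrite /A /= in_itv.
  by apply: measurable_trace_stat.
have ir y e : 0 < e -> haar.-integrable setT (EFin \o (fun g : T => ramp y e (W g))).
  move=> e0; apply: (@integrable_bounded_mfun _ _ _ _ _ 1).
    apply: measurableT_comp measurable_trace_stat.
    by apply: continuous_measurable_fun; exact: continuous_ramp.
  by move=> g; rewrite ger0_norm ?ramp_ge0 ?ramp_le1.
have iA : haar.-integrable setT (EFin \o (\1_A : T -> R)).
  apply: (@integrable_bounded_mfun _ _ _ _ _ 1); first exact: measurable_indic.
  by move=> g; rewrite indicE; case: (_ \in _); rewrite ?normr1 ?normr0.
have PA : fine (haar A) = \int[haar]_g \1_A g.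
  by rewrite /Rintegral integral_indic// setIT.
apply/ler_addgt0Pr => e e0; rewrite ler_norml PA; apply/andP; split.
- have /ler_normlP[+ _] := ramp_stat_bound (x0 - e) e0.
  have := gauss_cdf_le_ramp_mean (x0 - e) e0.
  have := @gauss_cdf_lip R (x0 - e) x0; rewrite lerBlDr lerDl ltW// => /(_ isT).
  have : \int[haar]_g ramp (x0 - e) e (W g) <= \int[haar]_g \1_A g.
    apply: le_Rintegral => //; first exact: ir.
    move=> g _; rewrite indicE; have [gA|gA] := boolP (g \in A); first exact: ramp_le1.
    rewrite ramp0// subrK leNgt; apply: contra gA => Wg.
    by rewrite inE /A /= ltW.
  lra.
- have /ler_normlP[_] := ramp_stat_bound x0 e0.
  have := ramp_mean_le_gauss_cdf x0 e0.
  have := @gauss_cdf_lip R x0 (x0 + e); rewrite lerDl ltW// => /(_ isT).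
  have : \int[haar]_g \1_A g <= \int[haar]_g ramp x0 e (W g).
    apply: le_Rintegral => //; first exact: ir.
    move=> g _; rewrite indicE; have [gA|gA] := boolP (g \in A); last exact: ramp_ge0.
    by rewrite ramp1//; move: gA; rewrite inE.
  lra.
Qed.

End moments.

Theorem theorem3p20 (R : realType) (n : nat) (hn : (2 <= n)%N)
    (haar : probability (borelType (unitary R n)) R) (hhaar : is_haar haar)
    (x0 : R) :
  `| fine (haar [set g | trace_stat g <= x0])
     - (Num.sqrt (2 * pi))^-1
       * \int[lebesgue_measure]_(x in `]-oo, x0]) expR (- (x ^+ 2 / 2)) |
  <= 2 / (n%:R - 1).
Proof.
(* The argument yields [2 / n], which is then weakened to the stated bound. *)
rewrite -gauss_cdfE; apply: (le_trans (trace_stat_cdf_bound hn hhaar x0)).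
have n1 : 0 < (n%:R - 1 : R) by rewrite subr_gt0 ltr1n.
by rewrite ler_wpM2l// lef_pV2 ?posrE// ?gerBl// ltr0n (leq_trans _ hn).
Qed.
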